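(* Let $X$ be a normal algebraic variety over $k$ and let $D$ be an effective Cartier divisor in $X$. Then the normalized generic fiber $]X[$ of the formal completion of $X$ along $D$ is angelic. If moreover $D$ is complete, then $]X[$ is sequentially compact.
   Context: Conventions: $k$ is an algebraically closed field, endowed with the trivial norm; a normal algebraic variety over $k$ is an irreducible, reduced, normal (separated) scheme of finite type over $k$. Complete means proper over $k$. A subset of a topological space is relatively $\omega$-compact if any sequence of points in this set has a cluster point in the ambient space. A topological space is angelic if any relatively $\omega$-compact subset is relatively compact and, for any subset $A$, any point in the closure $\bar A$ is the limit of a sequence of points in $A$. Normalized generic fiber $]X[$ (it depends on $D$). If $X=\mathrm{Spec}\,R$ is affine and $D=\{f=0\}$ with $f\in R$, the generic fiber $X_\eta$ of the formal completion of $X$ along $D$ is the set of functions $\nu: R\to \mathbb{R}_+\cup\{+\infty\}$ with $\nu(ab)=\nu(a)+\nu(b)$, $\nu(a+b)\ge\min\{\nu(a),\nu(b)\}$, $\nu(0)=+\infty$, $\nu=0$ on $k^*$ (the value $+\infty$ is allowed on non-zero elements), and $0<\nu(f)<+\infty$; equivalently, writing $|\cdot|=e^{-\nu}$, it is the set of multiplicative semi-norms $|\cdot|\le 1$ on $R$, trivial on $k$, with $0<|f|<1$. It carries the topology of pointwise convergence, i.e. the coarsest topology such that $|\cdot|\mapsto |g|$ is continuous for every $g\in R$. The normalized generic fiber $]X[\,\subset X_\eta$ is the subspace of those $\nu$ with $\nu(f)=1$. In general, cover $X$ by finitely many affine open sets $U_i$ on which $D$ is principal; $X_\eta$ (resp.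 $]X[$) is obtained by patching together the $U_{i,\eta}$ (resp. the $]U_i[$), where a point of $U_{i,\eta}$ and a point of $U_{j,\eta}$ are identified when both are restrictions of the same point of $(U_i\cap U_j)_\eta$, with the quotient topology. The result is independent of choices. *)

(* Defs.v *)
From HB Require Import structures.
From mathcomp Require Import all_boot all_order all_algebra.
From mathcomp Require Import all_classical all_reals all_analysis.
From Stdlib Require Import Relation_Operators.

Set Implicit Arguments.
Unset Strict Implicit.
Unset Printing Implicit Defensive.

Import Order.TTheory GRing.Theory Num.Theory.
Import numFieldNormedType.Exports.

Local Open Scope classical_set_scope.
Local Open Scope ring_scope.
Local Open Scope quotient_scope.

(** * Topology *)

Definition sequentially_compact (T : topologicalType) : Prop :=
  forall u : nat -> T, exists s : nat -> nat, exists x : T,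
    increasing_seq s /\ (u \o s) n @[n --> \oo] --> x.

Definition relatively_omega_compact (T : topologicalType) (A : set T) : Prop :=
  forall u : nat -> T, (forall n, A (u n)) ->
    exists x : T, cluster (u n @[n --> \oo]) x.

(* [precompact A] is equivalent to [compact (closure A)] by [precompactE]. *)
Definition angelic (T : topologicalType) : Prop :=
  (forall A : set T, relatively_omega_compact A -> precompact A) /\
  (forall (A : set T) (x : T), closure A x ->
    exists u : nat -> T, (forall n, A (u n)) /\ u n @[n --> \oo] --> x).

Definition irreducible_space (T : topologicalType) : Prop :=
  [set: T] !=set0 /\
  (forall A B : set T, closed A -> closed B -> A `|` B = setT ->
    A = setT \/ B = setT).

(** * Locally ringed spaces over a field *)

Definition ring_morphism (A B : pzRingType) (f : A -> B) : Prop :=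
  nmod_morphism f /\ monoid_morphism f.

(* Sections and restriction maps are total in their set arguments, but only
   their values on open sets, and on inclusions of open sets, are meaningful. *)
Definition unit_at (T : topologicalType) (O : set T -> comPzRingType)
    (r : forall U V : set T, O U -> O V) (U : set T) (s : O U) : set T :=
  [set x | exists V : set T, [/\ open V, V x, V `<=` U &
                                 exists t : O V, r U V s * t = 1]].

(* [unit_at] says that the germ of [s] at [x] is invertible, so [stalk_unit0]
   and [stalk_unitD] say that the stalk at [x] is a local ring: it is non-zero
   and its non-units are stable under addition.
   [cst] is the structural morphism to Spec k, i.e. it turns the structure sheaf
   into a sheaf of k-algebras. *)
Record lrspace (k : fieldType) := LRSpace {
  points :> topologicalType ;
  sec : set points -> comPzRingType ;
  res : forall U V : set points, sec U -> sec V ;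
  cst : forall U : set points, k -> sec U ;
  res_morphism : forall U V : set points, open U -> open V -> V `<=` U ->
    ring_morphism (@res U V) ;
  res_id : forall (U : set points) (s : sec U), open U -> res U s = s ;
  res_res : forall (U V W : set points) (s : sec U),
    open U -> open V -> open W -> V `<=` U -> W `<=` V ->
    res W (res V s) = res W s ;
  sheaf_glue : forall (C : set (set points)) (s : forall V, sec V),
    (forall V, C V -> open V) ->
    (forall V W, C V -> C W -> res (V `&` W) (s V) = res (V `&` W) (s W)) ->
    exists! t : sec (\bigcup_(V in C) V), forall V, C V -> res V t = s V ;
  cst_morphism : forall U : set points, open U -> ring_morphism (@cst U) ;
  res_cst : forall (U V : set points) (c : k), open U -> open V -> V `<=` U ->
    res V (cst U c) = cst V c ;
  stalk_unit0 : forall (U : set points) (x : points), open U -> U x ->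
    ~ unit_at res (0 : sec U) x ;
  stalk_unitD : forall (U : set points) (x : points) (s t : sec U),
    open U -> U x -> unit_at res (s + t) x ->
    unit_at res s x \/ unit_at res t x
}.

Arguments sec {k} X U : rename.
Arguments res {k X} U V s : rename.
Arguments cst {k} X U c : rename.

(* The open set where the section [s] does not vanish. *)
Definition nonvanishing (k : fieldType) (X : lrspace k) (U : set X)
  (s : sec X U) : set X := unit_at (@res k X) s.

Definition germ_zero (k : fieldType) (X : lrspace k) (U : set X)
    (s : sec X U) (x : X) : Prop :=
  exists V : set X, [/\ open V, V x, V `<=` U & res U V s = 0].

(** * Morphisms over k *)

Record mor (k : fieldType) (X Y : lrspace k) := Mor {
  mor_fun :> X -> Y ;
  comor : forall V : set Y, sec Y V -> sec X (mor_fun @^-1` V) ;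
  mor_continuous : continuous mor_fun ;
  comor_morphism : forall V : set Y, open V -> ring_morphism (@comor V) ;
  comor_res : forall (U V : set Y) (s : sec Y U),
    open U -> open V -> V `<=` U ->
    comor (res U V s) = res (mor_fun @^-1` U) (mor_fun @^-1` V) (comor s) ;
  comor_cst : forall (V : set Y) (c : k), open V ->
    comor (cst Y V c) = cst X (mor_fun @^-1` V) c ;
  comor_local : forall (V : set Y) (s : sec Y V) (x : X),
    open V -> V (mor_fun x) ->
    nonvanishing (comor s) x -> nonvanishing s (mor_fun x)
}.

Arguments comor {k X Y} f V s : rename.

(* Two equal maps have equal preimages only propositionally; the restriction
   transports sections from one preimage to the other. *)
Definition mor_eq (k : fieldType) (X Y : lrspace k) (f g : mor X Y) : Prop :=
  (forall x, f x = g x) /\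
  (forall (V : set Y) (s : sec Y V), open V ->
    res (f @^-1` V) (g @^-1` V) (comor f V s) = comor g V s).

Definition mor_id (k : fieldType) (X : lrspace k) : mor X X.
Proof.
refine (@Mor k X X id (fun V s => s) _ _ _ _ _) => //.
by move=> x; exact: cvg_id.
Defined.

Definition mor_comp (k : fieldType) (X Y Z : lrspace k)
  (f : mor X Y) (g : mor Y Z) : mor X Z.
Proof.
have og (V : set Z) : open V -> open (g @^-1` V).
  by move=> oV; apply: open_comp => // y _; exact: mor_continuous.
refine (@Mor k X Z (g \o f)
  (fun V s => comor f (g @^-1` V) (comor g V s)) _ _ _ _ _).
- by move=> x; apply: continuous_comp; exact: mor_continuous.
- move=> V oV; have [[g0 gD] [g1 gM]] := comor_morphism g oV.
  have [[f0 fD] [f1 fM]] := comor_morphism f (og _ oV).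
  split; split; rewrite ?g0 ?f0 ?g1 ?f1 //.
  + by move=> a b; rewrite gD fD.
  + by move=> a b; rewrite gM fM.
- move=> U V s oU oV VU; rewrite comor_res // comor_res //; try exact: og.
  by move=> y; exact: VU.
- by move=> V c oV; rewrite !comor_cst //; exact: og.
- move=> V s x oV Vx h; apply: comor_local => //.
  by apply: (comor_local (m := f)) h => //; exact: og.
Defined.

(** * Schemes *)

Definition prime_ideal (A : comPzRingType) (P : set A) : Prop :=
  [/\ P 0, ~ P 1,
      (forall a b, P a -> P b -> P (a + b)),
      (forall a b, P b -> P (a * b)) &
      (forall a b, P (a * b) -> P a \/ P b)].

(* (U, O|U) is isomorphic to Spec A, where A = O(U), via the canonical map that
   sends x to the ideal of the sections vanishing at x, which is prime because
   the stalk at x is local: this map is bijective, it is a homeomorphism (the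
   sets D(s) form a basis of U), and it identifies O(D(s)) with the
   localization A_s, which is the definition of the structure sheaf of Spec A. *)
Definition affine_open (k : fieldType) (X : lrspace k) (U : set X) : Prop :=
  [/\ open U,
      (forall P : set (sec X U), prime_ideal P ->
        exists! x : X, U x /\ P = [set s | ~ nonvanishing s x]),
      (forall (V : set X) (x : X), open V -> V `<=` U -> V x ->
        exists s : sec X U, nonvanishing s x /\ nonvanishing s `<=` V) &
      (forall s : sec X U, let res_s := res U (nonvanishing s) in
        [/\ exists t, res_s s * t = 1,
            (forall b, exists n : nat, exists a : sec X U,
               res_s a = b * res_s s ^+ n) &
            (forall a : sec X U, res_s a = 0 ->
               exists n : nat, a * s ^+ n = 0)])].

Definition is_scheme (k : fieldType) (X : lrspace k) : Prop :=
  forall x : X, exists U : set X, affine_open U /\ U x.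

Definition is_fiber_product (k : fieldType) (X Y P : lrspace k)
    (p : mor P X) (q : mor P Y) : Prop :=
  is_scheme P /\
  forall (Z : lrspace k) (a : mor Z X) (b : mor Z Y), is_scheme Z ->
    exists h : mor Z P,
      [/\ mor_eq (mor_comp h p) a, mor_eq (mor_comp h q) b &
          forall h' : mor Z P, mor_eq (mor_comp h' p) a ->
            mor_eq (mor_comp h' q) b -> mor_eq h h'].

(* A closed injective continuous map is a homeomorphism onto a closed subset;
   the last condition is the surjectivity of O_X -> i_* O_Z as a map of
   sheaves. *)
Definition closed_immersion (k : fieldType) (Z X : lrspace k)
    (i : mor Z X) : Prop :=
  [/\ injective i,
      (forall C : set Z, closed C -> closed (i @` C)) &
      (forall (V : set X) (s : sec Z (i @^-1` V)) (x : X), open V -> V x ->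
        exists W : set X, [/\ open W, W x, W `<=` V &
          exists t : sec X W,
            comor i W t = res (i @^-1` V) (i @^-1` W) s])].

Definition separated (k : fieldType) (X : lrspace k) : Prop :=
  forall (P : lrspace k) (p q : mor P X) (delta : mor X P),
    is_fiber_product p q ->
    mor_eq (mor_comp delta p) (mor_id X) ->
    mor_eq (mor_comp delta q) (mor_id X) ->
    closed_immersion delta.

Definition fg_algebra (k : fieldType) (X : lrspace k) (U : set X) : Prop :=
  exists g : seq (sec X U), forall S : set (sec X U),
    (forall c : k, S (cst X U c)) -> (forall a, a \in g -> S a) ->
    (forall a b, S a -> S b -> S (a + b)) ->
    (forall a b, S a -> S b -> S (a * b)) -> S = setT.

Definition finite_type (k : fieldType) (X : lrspace k) : Prop :=
  exists n : nat, exists U : 'I_n -> set X,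
    (forall j, affine_open (U j) /\ fg_algebra (U j)) /\
    \bigcup_j U j = setT.

Definition universally_closed (k : fieldType) (X : lrspace k) : Prop :=
  forall (Y P : lrspace k) (p : mor P X) (q : mor P Y),
    is_scheme Y -> is_fiber_product p q ->
    forall C : set P, closed C -> closed (q @` C).

Definition complete_scheme (k : fieldType) (X : lrspace k) : Prop :=
  [/\ is_scheme X, separated X, finite_type X & universally_closed X].

Definition reduced (k : fieldType) (X : lrspace k) : Prop :=
  forall (U : set X) (s : sec X U) (n : nat), open U -> s ^+ n = 0 -> s = 0.

(* The local ring at [x] is an integrally closed domain: for germs a and b <> 0
   at [x], if a/b is a root of T^n + \sum_(i < n) c_i T^i, then b divides a.
   Finitely many germs are all represented on a common neighborhood U. *)
Definition normal_at (k : fieldType) (X : lrspace k) (x : X) : Prop :=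
  (forall (U : set X) (a b : sec X U), open U -> U x ->
    germ_zero (a * b) x -> germ_zero a x \/ germ_zero b x) /\
  (forall (U : set X) (a b : sec X U) (n : nat) (c : 'I_n -> sec X U),
    open U -> U x -> ~ germ_zero b x ->
    germ_zero (a ^+ n + \sum_(i < n) c i * a ^+ i * b ^+ (n - i)) x ->
    exists V : set X, [/\ open V, V x, V `<=` U &
      exists d : sec X V, res U V a = d * res U V b]).

Definition normal_variety (k : fieldType) (X : lrspace k) : Prop :=
  [/\ is_scheme X, irreducible_space X & reduced X] /\
  [/\ forall x : X, normal_at x, separated X & finite_type X].

(* On the affine open set U, the ideal of D is generated by f. *)
Definition principal_on (k : fieldType) (X D : lrspace k) (i : mor D X)
    (U : set X) (f : sec X U) : Prop :=
  affine_open U /\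
  (forall a : sec X U, comor i U a = 0 <-> exists b, a = b * f).

(* Effective Cartier divisors, as closed subschemes whose ideal sheaf is locally
   generated by one non-zero-divisor. *)
Definition effective_cartier (k : fieldType) (X D : lrspace k)
    (i : mor D X) : Prop :=
  [/\ is_scheme D, closed_immersion i &
      forall x : X, exists U : set X, exists f : sec X U,
        [/\ U x, principal_on i f & forall a, a * f = 0 -> a = 0]].

(** * The normalized generic fiber *)

Section Fiber.
Variables (R : realType) (k : fieldType) (X : lrspace k).

Local Open Scope ereal_scope.

(* {ptws A -> B} carries the topology of pointwise convergence, and a set
   coerced to a type carries the subspace topology. *)
Definition semivaluation (U : set X) (nu : {ptws sec X U -> \bar R}) : Prop :=
  [/\ (forall a, 0 <= nu a),
      (forall a b, nu (a * b)%R = nu a + nu b),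
      (forall a b, Order.min (nu a) (nu b) <= nu (a + b)%R),
      nu 0%R = +oo &
      (forall c : k, c != 0%R -> nu (cst X U c) = 0)].

Definition affine_fiber (U : set X) (f : sec X U) :
    set {ptws sec X U -> \bar R} :=
  [set nu | semivaluation nu /\ 0 < nu f < +oo].

Definition normalized_affine_fiber (U : set X) (f : sec X U) :
    set {ptws sec X U -> \bar R} :=
  [set nu | affine_fiber f nu /\ nu f = 1].

End Fiber.

Arguments affine_fiber R {k X U} f.
Arguments normalized_affine_fiber R {k X U} f.

Record atlas (k : fieldType) (X D : lrspace k) (i : mor D X) := Atlas {
  atlas_size : nat ;
  chart : 'I_atlas_size -> set X ;
  equation : forall j, sec X (chart j) ;
  equationP : forall j, principal_on i (equation j) ;
  chart_cover : \bigcup_j chart j = setT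
}.

Arguments chart {k X D i} A j : rename.
Arguments equation {k X D i} A j : rename.

Section Gluing.
Variables (R : realType) (k : fieldType) (X D : lrspace k) (i : mor D X).
Variable A : atlas i.

Definition local_fiber (j : 'I_(atlas_size A)) : topologicalType :=
  normalized_affine_fiber R (equation A j).

Definition disjoint_fibers : topologicalType :=
  {j : 'I_(atlas_size A) & local_fiber j}.

(* The points of the generic fiber of U_j /\ U_l are those of the generic fibers
   of its affine open subsets W; when X is separated, U_j /\ U_l is itself affine
   and W = U_j /\ U_l suffices. *)
Definition patched (x y : disjoint_fibers) : Prop :=
  exists W : set X,
    [/\ affine_open W, W `<=` chart A (tag x), W `<=` chart A (tag y) &
        exists2 mu : {ptws sec X W -> \bar R},
          affine_fiber R (res _ W (equation A (tag x))) mu &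
          (forall a, \val (tagged x) a = mu (res _ W a)) /\
          (forall b, \val (tagged y) b = mu (res _ W b))].

Definition glue (x y : disjoint_fibers) : bool :=
  `[< clos_refl_sym_trans _ patched x y >].

Lemma glue_refl : reflexive glue.
Proof. by move=> x; apply/asboolP; exact: rst_refl. Qed.

Lemma glue_sym : symmetric glue.
Proof. by move=> x y; apply/asboolP/asboolP; exact: rst_sym. Qed.

Lemma glue_trans : transitive glue.
Proof.
by move=> y x z /asboolP xy /asboolP yz; apply/asboolP; exact: rst_trans xy yz.
Qed.

Definition glue_equiv : equiv_rel disjoint_fibers :=
  EquivRel glue glue_refl glue_sym glue_trans.

(* ]X[, computed from the finite affine cover [A]. *)
Definition normalized_generic_fiber : topologicalType :=
  quotient_topology {eq_quot glue_equiv}%qT.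

End Gluing.

(* Main.v *)
Require Import Defs.
From HB Require Import structures.
From mathcomp Require Import all_boot all_order all_algebra.
From mathcomp Require Import all_classical all_reals all_analysis.

Set Implicit Arguments.
Unset Strict Implicit.
Unset Printing Implicit Defensive.

Import Order.TTheory GRing.Theory Num.Theory.
Import numFieldNormedType.Exports.

Local Open Scope classical_set_scope.
Local Open Scope ring_scope.

(** The theorem rests on one countability property. Let [A] be a finitely
    generated algebra over [k] and let [nu] be a semivaluation on [A] that lies
    in the closure, for pointwise convergence, of each set of a sequence of sets
    of semivaluations. Then some sequence that takes its terms in these sets
    converges to [nu] ([semivaluation_strong_frechet]). The field may be
    uncountable, so [A] has uncountably many elements, but it is a countable
    union of spaces of finite dimension, and this makes it possible to control
    the terms [mu] of the sequence:
    - lower bounds: the ideal of the [a] with [nu a >= c'] is generated by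
      finitely many elements, by Hilbert's basis theorem
      ([noetherian_adjoin]), so it suffices that [mu > c] at these;
    - upper bounds: for [c < c'], the elements of a space of dimension [m] with
      [mu a >= c'] form a subspace. Choose every term of the sequence so that,
      for every set of previous terms, it is smaller than [c'] at some element
      with [nu a <= c] that lies in the subspaces of all the terms of the set,
      if there is one. The subspace of a new term then strictly cuts every
      intersection of previous ones that contains such an element, so from the
      step at which this condition is imposed, an element with [nu a <= c] lies
      in at most [m] of these subspaces ([avoiding_sequence],
      [no_triangular_family]).

    The normalized fiber of an affine chart is closed in a product of copies of
    the compact space [\bar R], hence compact ([normalized_compact]), and
    therefore so is the glued fiber. To transfer the countability property to
    the glued fiber, it is enough to know that the map from the fiber of an
    affine open subset to the glued fiber is closed ([glued_image_closed]). The
    reason is that every open subset of [X] is a finite union of affine open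
    subsets with finitely generated algebras ([finite_affine_coverP]). A
    semivaluation on an affine open subset has a center, which is a point, and
    it extends to every open subset that contains this center
    ([extend_semivaluation]). Thus two points of two charts are identified
    exactly when both are restrictions of one semivaluation on some member of a
    fixed finite affine cover of the intersection of these charts
    ([linked_trans], [linked_cover]), and this relation is a finite union of
    images of compact spaces.

    Sequential compactness follows: infinitely many terms of a sequence come
    from one of finitely many compact affine fibers; they have a cluster point
    there, to which a subsequence converges by the countability property applied
    to the tails of the sequence. *)

(** * Noetherian subrings and Hilbert's basis theorem *)

(** The choice of each term depends on the list of all the previous ones. *)
Lemma history_choice (T : Type) (P : seq T -> T -> Prop) :
  (forall h, exists y, P h y) ->
  exists f : nat -> T, forall n, P (mkseq f n) (f n).
Proof.
move=> /choice[next nextP].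
pose hist n := iter n (fun h => rcons h (next h)) [::].
exists (fun n => next (hist n)) => n.
suff -> : mkseq (fun m => next (hist m)) n = hist n by exact: nextP.
by elim: n => // n IHn; rewrite mkseqS IHn.
Qed.

Section Noetherian.
Variable A : comPzRingType.
Implicit Types B J P : set A.

(** Subrings and ideals are predicates on one fixed ring, which lets generators
    be adjoined inside this ring. With [B] the whole ring, [submodule B] means
    ideal; with [B] the image of a field, it means linear subspace. *)
Definition subring B :=
  [/\ B 1, forall a b, B a -> B b -> B (a - b) &
      forall a b, B a -> B b -> B (a * b)].

Definition submodule B J :=
  [/\ J 0, forall a b, J a -> J b -> J (a + b) &
      forall c a, B c -> J a -> J (c * a)].

Definition span B P : set A :=
  [set s | forall J, submodule B J -> P `<=` J -> J s].

Definition noetherian B :=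
  forall J, submodule B J -> J `<=` B ->
    exists l : seq A, (forall a, a \in l -> J a) /\ J `<=` span B [set` l].

Lemma submodule_span B P : submodule B (span B P).
Proof.
split=> [J [] // | a b Pa Pb J mJ PJ | c a Bc Pa J mJ PJ].
- by case: (mJ) => _ + _; apply; [exact: Pa|exact: Pb].
- by case: (mJ) => _ _; apply=> //; exact: Pa.
Qed.

Lemma sub_span B P : P `<=` span B P.
Proof. by move=> a Pa J _; exact. Qed.

Lemma span_min B P J : submodule B J -> P `<=` J -> span B P `<=` J.
Proof. by move=> mJ PJ a; exact. Qed.

Lemma span_mono B P Q : P `<=` Q -> span B P `<=` span B Q.
Proof.
by move=> PQ; apply: span_min; [exact: submodule_span|]; move=> a /PQ/sub_span.
Qed.

Lemma subring0 B : subring B -> B 0.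
Proof. by case=> B1 BB _; rewrite -(subrr 1); exact: BB. Qed.

Lemma subringD B a b : subring B -> B a -> B b -> B (a + b).
Proof.
move=> sB Ba Bb; have B0 := subring0 sB; case: sB => _ BB _.
by rewrite -[b]opprK -[- b]add0r; do 2!apply: (BB) => //.
Qed.

Lemma subringN B a : subring B -> B a -> B (- a).
Proof.
by move=> sB Ba; rewrite -[- a]add0r; case: (sB) => _ + _; apply=> //; exact: subring0.
Qed.

Lemma submoduleB B J a b : subring B -> submodule B J -> J a -> J b -> J (a - b).
Proof.
move=> sB [_ JD JM] Ja Jb; apply: JD => //; rewrite -mulN1r; apply: JM => //.
by apply: subringN => //; case: sB.
Qed.

(** The generators of the ideal spanned by [P] can be taken in [P], since each
    element of the span involves finitely many elements of [P]. *)
Lemma noetherian_span B P : noetherian B -> subring B -> P `<=` B ->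
  exists l : seq A, (forall a, a \in l -> P a) /\ P `<=` span B [set` l].
Proof.
move=> nB sB PB; have [_ _ BM] := sB.
have [] := nB (span B P) (submodule_span B P).
  by apply: span_min => //; split=> //; [exact: subring0|move=> *; exact: subringD].
move=> l [lP Pl].
suff [l' [l'P l'l]] : exists l' : seq A, (forall a, a \in l' -> P a) /\
    [set` l] `<=` span B [set` l'].
  exists l'; split=> // a Pa.
  by apply: (span_min (submodule_span B _) l'l); apply: Pl; exact: sub_span.
elim: l lP {Pl} => [|a l IHl] lP; first by exists [::].
have [|l1 [l1P ll1]] := IHl; first by move=> b bl; apply: lP; rewrite inE bl orbT.
suff [l2 [l2P al2]] : exists l2 : seq A, (forall a, a \in l2 -> P a) /\
    span B [set` l2] a.
  exists (l2 ++ l1); split=> [b|b /=].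
    by rewrite mem_cat => /orP[/l2P|/l1P].
  rewrite inE => /orP[/eqP->|/ll1]; [move: al2|]; apply: span_mono => c /=;
    by rewrite mem_cat => ->; rewrite ?orbT.
apply: (lP a (mem_head _ _)
  [set a | exists l2 : seq A, (forall a, a \in l2 -> P a) /\ span B [set` l2] a]).
- split.
  + by exists [::]; split=> //; case: (submodule_span B [set` [::]]).
  + move=> b c [lb [lbP blb]] [lc [lcP clc]]; exists (lb ++ lc); split.
      by move=> d; rewrite mem_cat => /orP[/lbP|/lcP].
    case: (submodule_span B [set` lb ++ lc]) => _ + _; apply.
      by apply: span_mono blb => d /=; rewrite mem_cat => ->.
    by apply: span_mono clc => d /=; rewrite mem_cat orbC => ->.
  + move=> c b Bc [lb [lbP blb]]; exists lb; split=> //.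
    by case: (submodule_span B [set` lb]) => _ _; exact.
- move=> b Pb; exists [:: b]; split; first by move=> c; rewrite inE => /eqP->.
  by apply: sub_span; rewrite /= inE.
Qed.

Section Adjoin.
Variables (B : set A) (x : A).
Hypothesis sB : subring B.

(** Values at [x] of the polynomials of degree less than [n] over [B]. *)
Fixpoint low n : set A :=
  if n is m.+1 then
    [set y | exists b r, [/\ B b, low m r & y = b * x ^+ m + r]]
  else [set 0].

Definition adjoin : set A := [set y | exists n, low n y].

Lemma low_mono m n y : (m <= n)%N -> low m y -> low n y.
Proof.
move=> /subnK <-; elim: (n - m)%N => // k IHk /IHk ly.
by exists 0, y; split=> //; [exact: subring0|rewrite mul0r add0r].
Qed.

Lemma low0 n : low n 0.
Proof. exact: (@low_mono 0). Qed.

Lemma lowD n y z : low n y -> low n z -> low n (y + z).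
Proof.
elim: n y z => [|n IHn] y z; first by move=> -> ->; rewrite /= addr0.
move=> [b [r [Bb lr ->]]] [c [s [Bc ls ->]]]; exists (b + c), (r + s).
by split; [exact: subringD|exact: IHn|rewrite mulrDl addrACA].
Qed.

Lemma lowZ n c y : B c -> low n y -> low n (c * y).
Proof.
move=> Bc; elim: n y => [|n IHn] y; first by move=> ->; rewrite /= mulr0.
move=> [b [r [Bb lr ->]]]; exists (c * b), (c * r).
split; [by case: sB => _ _; exact|exact: IHn|by rewrite mulrDr mulrA].
Qed.

Lemma lowXM k n y : low n y -> low (k + n) (x ^+ k * y).
Proof.
move=> ly; elim: k => [|k IHk]; first by rewrite mul1r.
rewrite exprS -mulrA; move: (x ^+ k * y) IHk => z; rewrite addSn.
elim: (k + n)%N z => [z -> | m IHm z]; first by rewrite mulr0; exact: low0.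
move=> [b [r [Bb /IHm lr ->]]]; exists b, (x * r); split=> //.
by rewrite mulrDr mulrCA exprS.
Qed.

Lemma submodule_adjoin : submodule B adjoin.
Proof.
split; first by exists 0%N.
- move=> y z [m ly] [n lz]; exists (maxn m n).
  by apply: lowD; [move: ly|move: lz]; apply: low_mono; rewrite ?leq_maxl ?leq_maxr.
- by move=> c y Bc [n ly]; exists n; exact: lowZ.
Qed.

Lemma sub_adjoin : B `<=` adjoin.
Proof. by move=> b Bb; exists 1%N, b, 0; rewrite mulr1 addr0. Qed.

Lemma adjoin_gen : adjoin x.
Proof.
exists 2%N, 1, 0; split; [by case: sB|exact: low0|by rewrite mul1r expr1 addr0].
Qed.

Lemma subring_adjoin : subring adjoin.
Proof.
have [_ CD CM] := submodule_adjoin; have B1 : B 1 by case: sB.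
split; first exact: sub_adjoin.
  move=> a b Ca Cb; apply: (CD) => //; rewrite -mulN1r; apply: CM => //.
  exact: subringN.
move=> a b [m la] [n lb]; elim: m a la => [a -> | m IHm a [c [r [Bc lr ->]]]].
  by rewrite mul0r; exists 0%N.
rewrite mulrDl; apply: (CD); last exact: IHm.
by rewrite -mulrA; apply: CM => //; exists (m + n)%N; exact: lowXM.
Qed.

(** Hilbert's basis theorem: in an ideal that is not finitely generated, choose
    elements of least degree outside the ideal generated by their predecessors;
    their degrees do not decrease, and a relation between their leading coefficients
    produces an element of smaller degree. *)
Lemma noetherian_adjoin : noetherian B -> noetherian adjoin.
Proof.
move=> nB J mJ JC; apply: contrapT => noJ.
have sC := subring_adjoin.
(* [y] is the value at [x] of a polynomial of degree at most [d] with
   coefficient [b] in degree [d]. *)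
pose lead d b y := B b /\ exists2 r, low d r & y = b * x ^+ d + r.
(* A term is an element of [J] with its degree and its leading coefficient. *)
pose P (h : seq (A * (nat * A))) (p : A * (nat * A)) :=
  (forall q, q \in h -> J q.1) ->
  [/\ J p.1, ~ span adjoin [set` map fst h] p.1, lead p.2.1 p.2.2 p.1 &
      forall y, J y -> ~ span adjoin [set` map fst h] y -> ~ low p.2.1 y].
have [|f fP] := @history_choice _ P.
  move=> h; have [Jh|nJh] := pselect (forall q, q \in h -> J q.1); last first.
    by exists (0, (0%N, 0)) => /nJh.
  have [y0 Jy0 hy0] : exists2 y, J y & ~ span adjoin [set` map fst h] y.
    apply: contrapT => noy; apply: noJ; exists (map fst h); split.
      by move=> a /mapP[q qh ->]; exact: Jh.
    by move=> y Jy; apply: contrapT => ny; apply: noy; exists y.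
  have ex : exists n, `[< exists y,
      [/\ J y, ~ span adjoin [set` map fst h] y & low n y] >].
    by have [n ly0] := JC _ Jy0; exists n; apply/asboolP; exists y0.
  case: (ex_minnP ex) => [[|d]] /asboolP[y [Jy hy]].
    move=> y00; case: hy; rewrite y00.
    by case: (submodule_span adjoin [set` map fst h]).
  move=> [b [r [Bb lr yE]]] dmin; exists (y, (d, b)) => _; split=> //=.
    by split=> //; exists r.
  move=> z Jz hz lz; suff : (d < d)%N by rewrite ltnn.
  by apply: dmin; apply/asboolP; exists z.
have Jf n : J (f n).1.
  elim/ltn_ind: n => n IHn; have [q|] // := fP n.
  by case/mapP=> i; rewrite mem_iota add0n /= => /IHn Ji ->.
have {fP} fP n : [/\ ~ span adjoin [set` map fst (mkseq f n)] (f n).1,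
      lead (f n).2.1 (f n).2.2 (f n).1 &
      forall y, J y -> ~ span adjoin [set` map fst (mkseq f n)] y ->
        ~ low (f n).2.1 y].
  by have [] := fP n; first by move=> q /mapP[i _ ->].
have hist i n : (i < n)%N -> (f i).1 \in map fst (mkseq f n).
  by move=> lin; apply: map_f; apply: map_f; rewrite mem_iota.
have degM i n : (i <= n)%N -> ((f i).2.1 <= (f n).2.1)%N.
  move=> lin; rewrite leqNgt; apply/negP => ltd.
  have [_ _ /(_ _ (Jf n))] := fP i; apply; last first.
    have [_ [Bb [r lr ->]] _] := fP n.
    by apply: low_mono ltd _; exists (f n).2.2, r.
  have [+ _ _] := fP n; apply: contra_not; apply: span_mono => a.
  move=> /mapP[q /mapP[j + ->] ->]; rewrite mem_iota add0n /= => lji.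
  by apply: hist; exact: leq_trans lin.
pose L n := span B [set (f i).2.2 | i in `I_n].
have LM m n : (m <= n)%N -> L m `<=` L n.
  move=> lmn; apply: span_mono => _ [i /= im <-]; exists i => //=.
  exact: leq_trans lmn.
have [] := nB (\bigcup_n L n).
- split; first by exists 0%N => //; case: (submodule_span B [set (f i).2.2 | i in `I_0]).
  + move=> a b [m _ La] [n _ Lb]; exists (maxn m n) => //.
    case: (submodule_span B [set (f i).2.2 | i in `I_(maxn m n)]) => _ + _; apply.
      by apply: LM La; exact: leq_maxl.
    by apply: LM Lb; exact: leq_maxr.
  + move=> c a Bc [m _ La]; exists m => //.
    by case: (submodule_span B [set (f i).2.2 | i in `I_m]) => _ _; exact.
- move=> a [n _]; apply: (span_min (J := B)).
    split; [exact: subring0|by move=> *; exact: subringD|by case: sB].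
  by move=> _ [i _ <-]; have [_ [] ] := fP i.
move=> l [lL Ll].
have [N lN] : exists N, [set` l] `<=` L N.
  elim: l lL {Ll} => [|a l IHl] lL; first by exists 0%N.
  have [|N lN] := IHl; first by move=> b bl; apply: lL; rewrite inE bl orbT.
  have [M _ aM] := lL a (mem_head _ _); exists (maxn M N) => b /=.
  rewrite inE => /orP[/eqP->|/lN]; last by apply: LM; exact: leq_maxr.
  by apply: LM aM; exact: leq_maxl.
have : L N (f N).2.2.
  apply: (span_min (submodule_span B _) lN); apply: Ll; exists N.+1 => //.
  by apply: sub_span; exists N => /=.
(* The leading coefficients that occur, in the degree of the term [N], in the
   ideal generated by the previous terms. *)
pose J0 b := exists2 g, span adjoin [set` map fst (mkseq f N)] g &
  lead (f N).2.1 b g.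
have [S0 SD SM] := submodule_span adjoin [set` map fst (mkseq f N)].
have B0 := subring0 sB.
move=> /(_ J0)[].
- split.
  + exists 0 => //; split=> //; exists 0; first exact: low0.
    by rewrite mul0r addr0.
  + move=> b c [g Sg [Bb [r lr gE]]] [h Sh [Bc [s ls hE]]].
    exists (g + h); first exact: SD.
    split; first exact: subringD.
    by exists (r + s); [exact: lowD|rewrite gE hE mulrDl addrACA].
  + move=> c b Bc [g Sg [Bb [r lr gE]]]; exists (c * g).
      by apply: SM => //; exact: sub_adjoin.
    split; first by case: sB => _ _; exact.
    by exists (c * r); [exact: lowZ|rewrite gE mulrDr mulrA].
- move=> _ [i /= iN <-]; have [_ [Bb [r lr fiE]] _] := fP i.
  have di := degM _ _ (ltnW iN).
  exists (x ^+ ((f N).2.1 - (f i).2.1) * (f i).1).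
    apply: SM; last by apply: sub_span; exact: hist.
    have [C1 _ CM] := sC; elim: (_ - _)%N => [|k IHk]; rewrite ?expr0 // exprS.
    by apply: CM => //; exact: adjoin_gen.
  split=> //; exists (x ^+ ((f N).2.1 - (f i).2.1) * r).
    by rewrite -{1}(subnK di); exact: lowXM.
  by rewrite {1}fiE mulrDr mulrCA -exprD subnK.
move=> g Sg [_ [r lr gE]]; have [nS [_ [s ls fE]] fmin] := fP N.
have Jg : J g.
  apply: (span_min mJ) Sg => _ /mapP[q /mapP[j _ ->] ->]; exact: Jf.
apply: (fmin ((f N).1 - g)).
- exact: (submoduleB sC).
- by move=> Sfg; apply: nS; rewrite -[(f N).1](subrK g); exact: SD.
- rewrite fE gE opprD addrACA subrr add0r; apply: lowD => //.
  by rewrite -mulN1r; apply: lowZ => //; apply: subringN => //; case: sB.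
Qed.

End Adjoin.
End Noetherian.

(** * Finitely generated algebras over a field *)

Section Algebra.
Variables (k : fieldType) (A : comPzRingType) (f : k -> A).
Hypothesis fM : ring_morphism f.

(** For the structural morphism of the sections on [U], this is
    [fg_algebra U]. *)
Definition finitely_generated := exists g : seq A, forall S : set A,
  (forall c, S (f c)) -> (forall a, a \in g -> S a) ->
  (forall a b, S a -> S b -> S (a + b)) ->
  (forall a b, S a -> S b -> S (a * b)) -> S = setT.

Lemma scalar_sum (I : finType) (c : I -> k) :
  f (\sum_i c i) = \sum_i f (c i).
Proof. by case: fM => -[f0 fD] _; apply: big_morph. Qed.

Lemma scalarM a b : f (a * b) = f a * f b.
Proof. by case: fM => _ [_ ->]. Qed.

Lemma subring_scalars : subring (range f).
Proof.
case: fM => -[f0 fD] [f1 fMM].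
have fN c : f (- c) = - f c.
  by apply/eqP; rewrite -addr_eq0 -fD addNr f0.
split; first by exists 1.
- by move=> _ _ [a _ <-] [b _ <-]; exists (a - b); rewrite // fD fN.
- by move=> _ _ [a _ <-] [b _ <-]; exists (a * b); rewrite // fMM.
Qed.

Lemma noetherian_scalars : noetherian (range f).
Proof.
move=> J mJ Jf; have [f0 f1] : f 0 = 0 /\ f 1 = 1 by case: fM => -[? _] [].
have [[c [c0 Jc]]|noc] := pselect (exists c, c != 0 /\ J (f c)).
  exists [:: f c]; split=> [a|a /Jf[d _ <-]]; first by rewrite inE => /eqP ->.
  have [_ _ SM] := submodule_span (range f) [set` [:: f c]].
  rewrite -[d](divfK c0) scalarM; apply: SM; first by exists (d / c).
  by apply: sub_span; rewrite /= inE.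
exists [::]; split=> // a Ja; have [d _ da] := Jf _ Ja.
have -> : a = 0.
  rewrite -da; have [->//|d0] := eqVneq d 0.
  by case: noc; exists d; rewrite da.
by case: (submodule_span (range f) [set` [::]]).
Qed.

Lemma finitely_generated_noetherian :
  finitely_generated -> noetherian [set: A].
Proof.
move=> [g gP].
have [B [sB nB fB gB]] : exists B, [/\ subring B, noetherian B,
    range f `<=` B & forall a, a \in g -> B a].
  elim: g {gP} => [|a g [B [sB nB fB gB]]].
    exists (range f); split=> //; first exact: subring_scalars.
    exact: noetherian_scalars.
  exists (adjoin B a); split.
  - exact: subring_adjoin.
  - exact: noetherian_adjoin.
  - by move=> b /fB; exact: sub_adjoin.
  - move=> b; rewrite inE => /orP[/eqP->|/gB]; first exact: adjoin_gen.
    exact: sub_adjoin.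
rewrite -(gP B) //.
- by move=> c; apply: fB; exists c.
- by move=> *; exact: subringD.
- by case: sB.
Qed.

(** The monomials in the generators form a countable spanning family. *)
Lemma finitely_generated_countable : finitely_generated ->
  exists e : nat -> A, forall a, span (range f) (range e) a.
Proof.
move=> [g gP].
pose mon (w : seq nat) := \prod_(i <- w) g`_i.
pose e n := if unpickle n is Some w then mon w else 0.
exists e => a; suff -> : span (range f) (range e) = setT by [].
have mS := submodule_span (range f) (range e); have [S0 SD SM] := mS.
have monS w : span (range f) (range e) (mon w).
  by apply: sub_span; exists (pickle w); rewrite // /e pickleK.
apply: gP => //.
- move=> c; rewrite -[f c]mulr1; apply: SM; first by exists c.
  by have := monS [::]; rewrite /mon big_nil.
- move=> b bg; have := monS [:: index b g].
  by rewrite /mon big_seq1 nth_index.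
have sub_e (P : set A) : submodule (range f) P -> (forall w, P (mon w)) ->
    span (range f) (range e) `<=` P.
  move=> mP Pw; apply: span_min => // _ [n _ <-]; rewrite /e.
  by case: unpickle => // *; case: mP.
have mMl b : submodule (range f)
    [set c | span (range f) (range e) (c * b)].
  split=> /=; first by rewrite mul0r.
    by move=> c d *; rewrite mulrDl; exact: SD.
  by move=> c d *; rewrite -mulrA; exact: SM.
move=> b c Sb Sc; apply: (sub_e _ (mMl c)) Sb => v /=.
rewrite mulrC; apply: (sub_e _ (mMl (mon v))) Sc => w /=.
by rewrite /mon -big_cat; exact: monS.
Qed.

Variable e : nat -> A.

Definition lincomb n : set A :=
  [set a | exists c : nat -> k, a = \sum_(l < n) f (c l) * e l].

Lemma lincomb_mono m n : (m <= n)%N -> lincomb m `<=` lincomb n.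
Proof.
move=> /subnK <- a am; elim: (n - m)%N => // d [c ac].
exists (fun l => if (l < d + m)%N then c l else 0).
rewrite addSn big_ord_recr /= ltnn; have -> : f 0 = 0 by case: fM => -[].
by rewrite mul0r addr0 ac; apply: eq_bigr => l _; rewrite ltn_ord.
Qed.

Lemma span_lincomb : span (range f) (range e) `<=` \bigcup_n lincomb n.
Proof.
have [[f0 fD] [f1 fMM]] := fM.
apply: span_min.
- split; first by exists 0%N => //; exists (fun=> 0); rewrite big_ord0.
  + move=> a b [m _ am] [n _ bn]; exists (maxn m n) => //.
    have [c ->] := lincomb_mono (leq_maxl m n) am.
    have [d ->] := lincomb_mono (leq_maxr m n) bn.
    exists (fun l => c l + d l); rewrite -big_split; apply: eq_bigr => l _.
    by rewrite fD mulrDl.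
  + move=> _ a [b _ <-] [n _ [c ->]]; exists n => //.
    exists (fun l => b * c l); rewrite mulr_sumr; apply: eq_bigr => l _.
    by rewrite fMM mulrA.
- move=> _ [n _ <-]; exists n.+1 => //.
  exists (fun l => (l == n)%:R); rewrite big_ord_recr /= eqxx f1 mul1r big1.
    by rewrite add0r.
  by move=> l _; rewrite (ltn_eqF (ltn_ord l)) f0 mul0r.
Qed.

(** Vectors that are separated by subspaces in a triangular way are linearly
    independent, so there are at most [m] of them in [lincomb m]. *)
Lemma no_triangular_family m (v : nat -> A) (W : nat -> set A) :
  (forall a, (a <= m)%N -> lincomb m (v a)) ->
  (forall a, submodule (range f) (W a)) ->
  (forall a b, (a < b <= m)%N -> W a (v b)) ->
  exists2 a, (a <= m)%N & W a (v a).
Proof.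
move=> vm mW vW; apply: contrapT => nov.
have /choice[c cE] (a : 'I_m.+1) : exists c : nat -> k,
    v a = \sum_(l < m) f (c l) * e l.
  by have [c ->] := vm a (ltn_ord a); exists c.
(* A linear relation between the [m.+1] vectors; its first nonzero coefficient
   expresses a vector through later ones. *)
pose M : 'M[k]_(m.+1, m) := \matrix_(a, l) c a l.
have : kermx M != 0.
  rewrite -mxrank_eq0 mxrank_ker -lt0n subn_gt0.
  exact: leq_ltn_trans (rank_leq_col M) _.
case/rowV0Pn => u /sub_kermxP uM u0.
have uv : \sum_a f (u 0 a) * v a = 0.
  under eq_bigr do rewrite cE mulr_sumr; rewrite exchange_big big1 //= => l _.
  under eq_bigr do rewrite mulrA -scalarM; rewrite -mulr_suml -scalar_sum.
  have /matrixP/(_ 0 l) := uM; rewrite !mxE.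
  under eq_bigr do rewrite mxE; move=> ->.
  by have -> : f 0 = 0 by [case: fM => -[]]; rewrite mul0r.
have [a ua] : exists a, u 0 a != 0.
  by apply/existsP; apply: contraNT u0 => /existsPn u0; apply/eqP/rowP => a;
    rewrite mxE; apply/eqP; rewrite -[_ == _]negbK.
case: (@arg_minnP _ a (fun a => u 0 a != 0) (@nat_of_ord _)) => // b ub bmin.
case: nov; exists b; first by rewrite -ltnS.
have [W0 WD WM] := mW b; have sf := subring_scalars.
have -> : v b = - f ((u 0 b)^-1) * \sum_(a | a != b) f (u 0 a) * v a.
  have := uv; rewrite (bigD1 b) //= => /eqP; rewrite addr_eq0 => /eqP uvb.
  rewrite mulNr -mulrN -uvb mulrA -scalarM mulVf //.
  by have -> : f 1 = 1 by [case: fM => _ []]; rewrite mul1r.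
apply: (WM); first by apply: subringN => //; exists (u 0 b)^-1.
apply: (big_ind (W b)) => [//|x y|d db]; first exact: WD.
have [->|ud] := eqVneq (u 0 d) 0.
  by have -> : f 0 = 0 by [case: fM => -[]]; rewrite mul0r.
apply: WM; first by exists (u 0 d).
apply: vW; rewrite leq_ord andbT ltn_neqAle bmin // andbT.
by rewrite -val_eqE eq_sym in db.
Qed.

End Algebra.

(** * Convergence and choice of sequences *)

Lemma cvg_initial (S : choiceType) (T : topologicalType) (f : S -> T)
    (F : set_system S) (s : S) : Filter F ->
  F --> (s : initial_topology f) <-> f @ F --> f s.
Proof.
move=> FF; split=> [Fs|Ffs].
  by apply: cvg_trans (@initial_continuous S T f s); exact: cvg_app.
move=> B [_ [[C oC <-] Cs CB]]; apply: (filterS CB).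
by apply: Ffs; exact: open_nbhs_nbhs.
Qed.

Lemma cvg_ptws (I : Type) (T : topologicalType) (F : set_system (I -> T))
    (f : I -> T) : Filter F ->
  F --> (f : {ptws I -> T}) <-> forall i, (g i @[g --> F]) --> f i.
Proof.
move=> FF; rewrite cvg_sup; split=> H i; have := H i; by rewrite cvg_initial.
Qed.

Lemma ptws_eval (I : Type) (T : topologicalType) (i : I) :
  continuous (fun f : {ptws I -> T} => f i).
Proof. by move=> f; have /cvg_ptws := @cvg_id _ (nbhs (f : {ptws I -> T})); exact. Qed.

Lemma ereal_cvg_order (R : realType) (F : set_system (\bar R)) (x : \bar R) :
  Filter F -> (forall a, (a < x)%E -> F [set y | (a < y)%E]) ->
  (forall b, (x < b)%E -> F [set y | (y < b)%E]) -> F --> x.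
Proof.
move=> FF lF uF B; rewrite itv_nbhsE => -[[l u] [oi xi] iB].
apply: (filterS iB); have FT : F setT by exact: filterT.
have -> : [set` Interval l u] = [set` Interval l +oo%O] `&` [set` Interval -oo%O u].
  apply/seteqP; split=> y /=; rewrite /= !itv_boundlr /= ?bound_lex1 ?andbT;
    by [move=> /andP[]|move=> [-> ->]].
move: oi xi; rewrite itv_boundlr => oi /andP[lx xu].
apply: filterI.
  case: l oi lx {iB} => [b l|b] oi lx; last first.
    have -> := itv_open_ends_linfty oi.
    by apply: filterS FT => y _; rewrite /= in_itv.
  have bE := itv_open_ends_lside oi; rewrite bE in lx *.
  by apply: filterS (lF l lx) => y /=; rewrite in_itv /= andbT.
case: u oi xu {iB} => [b u|b] oi xu; last first.
  have -> := itv_open_ends_rinfty oi.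
  by apply: filterS FT => y _; rewrite /= in_itv.
have bE := itv_open_ends_rside oi; rewrite bE in xu *.
by apply: filterS (uF u xu) => y /=; rewrite in_itv.
Qed.

Lemma ereal_cvg_unique (R : realType) (T : Type) (F : set_system T)
    (f : T -> \bar R) (x y : \bar R) : ProperFilter F ->
  f t @[t --> F] --> x -> f t @[t --> F] --> y -> x = y.
Proof.
move=> FF Fx Fy.
exact: (@cvg_unique _ (@ereal_hausdorff R) _ (fmap_proper_filter _ FF) _ _ Fx Fy).
Qed.

Lemma ereal_rat_dense (R : realType) (x y : \bar R) : (x < y)%E ->
  exists q : rat, (x < (ratr q)%:E < y)%E.
Proof.
move=> xy; suff [r [s [xr rs sy]]] : exists r s : R,
    [/\ (x <= r%:E)%E, r < s & (s%:E <= y)%E].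
  have [q] := rat_in_itvoo rs; rewrite in_itv /= => /andP[rq qs].
  exists q; rewrite (le_lt_trans xr) ?lte_fin //=.
  by apply: lt_le_trans sy; rewrite lte_fin.
case: x y xy => [r||] [s||] // rs.
- by exists r, s.
- by exists r, (r + 1); split=> //; rewrite ?ltrDl ?leey.
- by exists (s - 1), s; split=> //; rewrite ?gtrDl ?ltrN10 ?leNye.
- by exists 0, 1; split=> //; rewrite ?leNye ?leey.
Qed.

(** An ultrafilter converges to the supremum of the [x] such that [[x, +oo]]
    belongs to it. *)
Lemma ereal_compact (R : realType) : compact [set: \bar R].
Proof.
rewrite compact_ultra => F FU _.
pose c := ereal_sup [set x | F [set y | (x <= y)%E]].
exists c; split=> //; apply: ereal_cvg_order => [a ac|b cb].
  have [x Fx ax] := ereal_sup_gt ac.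
  by apply: filterS Fx => y; exact: lt_le_trans.
have [Fb|] := in_ultra_setVsetC [set y | (b <= y)%E] FU.
  have : (b <= c)%E by exact: ereal_sup_ubound.
  by rewrite leNgt cb.
by apply: filterS => y /= /negP; rewrite -ltNge.
Qed.

(** The elements [g] of [C j] are to be avoided by the sets [B j (y n)], for all
    large [n]. At step [n], for [j <= n] and for every subset [S] of the previous
    terms, one element of [C j] that lies in [B j y] for all [y] in [S] is
    selected, if there is one, and the new term is chosen to avoid it. If some
    [g] in [C j] belonged to infinitely many [B j (y n)], all these selections
    would exist along the corresponding terms and would form a triangular family
    longer than the bound [m j] permits. *)
Lemma avoiding_sequence (T : topologicalType) (G : Type) (x : T)
    (C : nat -> set G) (B : nat -> T -> set G) (m : nat -> nat)
    (E : set T) (A : nat -> set T) :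
  (forall j g, C j g -> \forall y \near x, ~ B j y g) ->
  (forall j (y : nat -> T) (g : nat -> G),
    (forall a, E (y a)) -> (forall a, (a <= m j)%N -> C j (g a)) ->
    (forall a b, (a < b <= m j)%N -> B j (y a) (g b)) ->
    exists2 a, (a <= m j)%N & B j (y a) (g a)) ->
  (forall n, A n `<=` E) -> (forall n, closure (A n) x) ->
  exists y : nat -> T, (forall n, A n (y n)) /\
    forall j g, C j g -> \forall n \near \oo, ~ B j (y n) g.
Proof.
move=> BC triang AE clA.
have /choice[sel selP] (p : nat * set T) : exists o : option G,
    if o is Some g then C p.1 g /\ (forall y, p.2 y -> B p.1 y g)
    else forall g, C p.1 g -> ~ (forall y, p.2 y -> B p.1 y g).
  have [[g [Cg Bg]]|nog] := pselect (exists g, C p.1 g /\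
    (forall y, p.2 y -> B p.1 y g)); first by exists (Some g).
  by exists None => g Cg Bg; apply: nog; exists g.
pose sub (h : seq T) (S : {set 'I_(size h)}) := [set nth x h i | i in [set` S]].
pose P (h : seq T) y := A (size h) y /\
  forall (j : 'I_(size h).+1) (S : {set 'I_(size h)}),
    if sel (j : nat, sub h S) is Some g then ~ B j y g else True.
have [|y yP] := @history_choice _ P.
  move=> h; have : \forall y \near x,
      forall (j : 'I_(size h).+1) (S : {set 'I_(size h)}),
      if sel (j : nat, sub h S) is Some g then ~ B j y g else True.
    apply: filter_forall => j; apply: filter_forall => S.
    have := selP (j : nat, sub h S); case: (sel _) => [g [Cg _]|_].
      exact: BC.
    exact: filterT.
  by move=> /(clA (size h))[y [Ay yP]]; exists y.
exists y; split=> [n|j g Cg].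
  by have [+ _] := yP n; rewrite size_mkseq.
apply: contrapT => nB.
have /choice[next nextP] (N : nat) : exists n, (N <= n)%N /\ B j (y n) g.
  apply: contrapT => nN; apply: nB; exists N => // n /= Nn Bn.
  by apply: nN; exists n.
(* The terms [y (phi a)] are the ones for which [g] is not avoided. *)
pose phi := fix phi a := if a is b.+1 then next (phi b).+1 else next j.
have phi_lt a b : (a < b)%N -> (phi a < phi b)%N.
  elim: b => // b IHb; rewrite ltnS leq_eqVlt => /orP[/eqP->|/IHb ab].
    by have [] := nextP (phi b).+1.
  by apply: (ltn_trans ab); have [] := nextP (phi b).+1.
have phi_ge a : (j <= phi a)%N.
  have j0 : (j <= phi 0)%N by have [] := nextP j.
  case: a => // a; apply: (leq_trans j0); apply: ltnW; exact: phi_lt.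
have phiB a : B j (y (phi a)) g.
  by case: a => [|a]; [case: (nextP j)|case: (nextP (phi a).+1)].
pose D b := [set y (phi a) | a in `I_b].
have /choice[gs gsP] b : exists g', [/\ C j g',
    forall a, (a < b)%N -> B j (y (phi a)) g' & ~ B j (y (phi b)) g'].
  have [_] := yP (phi b).
  have jb : (j < (size (mkseq y (phi b))).+1)%N by rewrite size_mkseq ltnS.
  pose S := [set i : 'I_(size (mkseq y (phi b))) |
    `[< exists2 a, (a < b)%N & phi a = i >]]%SET.
  move=> /(_ (Ordinal jb) S) /=.
  have -> : sub (mkseq y (phi b)) S = D b.
    apply/seteqP; split=> z.
      move=> [i /=]; rewrite inE => /asboolP[a ab ai] <-; exists a => //.
      by rewrite nth_mkseq -?ai //; exact: phi_lt.
    move=> [a /= ab <-].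
    have pab : (phi a < size (mkseq y (phi b)))%N.
      by rewrite size_mkseq; exact: phi_lt.
    exists (Ordinal pab) => /=; first by rewrite inE; apply/asboolP; exists a.
    by rewrite nth_mkseq //; exact: phi_lt.
  have := selP (j, D b); case: (sel _) => [g' [/= Cg' Bg'] nBg'|/(_ g Cg)].
    by exists g'; split=> // a ab; apply: Bg'; exists a.
  by case=> _ [a _ <-].
have [] := triang j (y \o phi) gs.
- by move=> a; apply: (AE (phi a)); have [+ _] := yP (phi a); rewrite size_mkseq.
- by move=> a _; have [] := gsP a.
- by move=> a b /andP[ab _]; have [_ + _] := gsP b; exact.
- by move=> a _; have [] := gsP a.
Qed.

(** * Spaces of semivaluations *)

Section Semivaluations.
Variables (R : realType) (k : fieldType) (X : lrspace k) (U : set X).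
Hypothesis oU : open U.
Local Notation fsp := {ptws sec X U -> \bar R}.
Implicit Types (nu mu : fsp) (a b : sec X U).

Lemma semivaluation1 nu : semivaluation nu -> nu 1 = 0%E.
Proof.
case=> _ _ _ _ /(_ 1 (oner_neq0 _)) <-; congr (nu _).
by case: (cst_morphism oU) => _ [->].
Qed.

Lemma semivaluationX nu a n : semivaluation nu -> nu a = 0%E ->
  nu (a ^+ n) = 0%E.
Proof.
move=> snu a0; elim: n => [|n IHn]; first exact: semivaluation1.
by rewrite exprS; case: snu => _ -> _ _ _; rewrite a0 IHn adde0.
Qed.

Lemma submodule_ge (B : set (sec X U)) nu c : semivaluation nu ->
  submodule B [set a | (c <= nu a)%E].
Proof.
case=> [p M mn z _]; split=> /=; first by rewrite z leey.
  by move=> a b ca cb; apply: le_trans (mn a b); rewrite le_min ca.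
by move=> a b _ cb; rewrite M; apply: le_trans cb _; rewrite leeDr.
Qed.

Lemma submodule_gt (B : set (sec X U)) nu (c : R) : semivaluation nu ->
  submodule B [set a | (c%:E < nu a)%E].
Proof.
case=> [p M mn z _]; split=> /=; first by rewrite z ltry.
  by move=> a b ca cb; apply: lt_le_trans (mn a b); rewrite lt_min ca.
by move=> a b _ cb; rewrite M; apply: lt_le_trans cb _; rewrite leeDr.
Qed.

Lemma ptws_limit_eq (F : set_system fsp) nu a c : ProperFilter F ->
  F --> nu -> (\forall mu \near F, mu a = c) -> nu a = c.
Proof.
move=> FF Fnu Fa; have {}Fa : \forall mu \near F, cst c mu = mu a.
  by apply: filterS Fa.
have Fc : mu a @[mu --> F] --> c by apply: cvg_trans (near_eq_cvg Fa) (cvg_cst c).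
have /cvg_ptws/(_ a) Fn := Fnu.
exact: ereal_cvg_unique Fn Fc.
Qed.

(** The additivity condition passes to the limit because the values are
    nonnegative, so that [+oo - oo] does not occur. *)
Lemma semivaluation_closed : closed [set nu : fsp | semivaluation nu].
Proof.
move=> nu; rewrite closureEcvg => -[F FF [Fnu FS]].
have Fs : \forall mu \near F, semivaluation mu by exact: FS.
have /cvg_ptws Fev := Fnu.
have p a : (0 <= nu a)%E.
  apply: (closed_cvg (fun x : \bar R => 0 <= x)%E _ _ (nu a) (Fev a)).
    exact: closed_ereal_le_ereal.
  by apply: filterS Fs => mu [].
split=> //.
- move=> a b; have ab0 : (nu a +? nu b)%E by rewrite ge0_adde_def // inE.
  have Fab : (mu a + mu b)%E @[mu --> F] --> (nu a + nu b)%E by exact: cvgeD.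
  have Fe : mu (a * b) @[mu --> F] `=>` (mu a + mu b)%E @[mu --> F].
    by apply: near_eq_cvg; apply: filterS Fs => mu [] _ ->.
  exact: ereal_cvg_unique (Fev _) (cvg_trans Fe Fab).
- move=> a b; rewrite leNgt; apply/negP => /ereal_rat_dense[q].
  rewrite lt_min => /andP[nq /andP[qa qb]].
  have near_lt c : ((ratr q)%:E < nu c)%E ->
      \forall mu \near F, ((ratr q)%:E < mu c)%E.
    by move=> qc; exact: (Fev c _ (open_ereal_gt' qc)).
  have nearab : \forall mu \near F, (mu (a + b)%R < (ratr q)%:E)%E.
    exact: (Fev (a + b) _ (open_ereal_lt' nq)).
  apply: (@filter_not_empty _ F).
  apply: filterS (filterI Fs (filterI nearab (filterI (near_lt a qa) (near_lt b qb)))).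
  move=> mu [[_ _ mn _ _] [muab [mua mub]]].
  have := le_lt_trans (mn a b) muab.
  by rewrite gt_min !ltNge !ltW.
- by apply: ptws_limit_eq Fnu _; apply: filterS Fs => mu [].
- move=> c c0; apply: ptws_limit_eq Fnu _; apply: filterS Fs => mu [_ _ _ _].
  exact.
Qed.

Definition normalized (F : set (sec X U)) : set fsp :=
  [set nu | semivaluation nu /\ forall f, F f -> nu f = 1%E].

Lemma normalized_compact (F : set (sec X U)) : compact (normalized F).
Proof.
apply: (@subclosed_compact _ _ [set nu : fsp | forall a, [set: \bar R] (nu a)]);
    last by move=> nu.
  have -> : normalized F = [set nu : fsp | semivaluation nu] `&`
      \bigcap_(f in F) [set nu : fsp | nu f = 1%E].
    by apply/seteqP; split=> nu [].
  apply: closedI; first exact: semivaluation_closed.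
  apply: closed_bigI => f _ nu; rewrite closureEcvg => -[G GG [Gnu Gf]].
  by apply: ptws_limit_eq Gnu _; exact: Gf.
exact: (@tychonoff (sec X U) (fun=> \bar R : topologicalType) (fun=> setT)
  (fun=> @ereal_compact R)).
Qed.

Lemma ptws_hausdorff : hausdorff_space fsp.
Proof.
apply: (@hausdorff_product (sec X U) (fun=> \bar R : topologicalType)) => _.
exact: ereal_hausdorff.
Qed.

Lemma near_ptws_gt (nu : fsp) a x : (x < nu a)%E ->
  nbhs nu [set mu : fsp | (x < mu a)%E].
Proof.
move=> xa; exact: (@ptws_eval _ (\bar R) a nu [set y | (x < y)%E]
  (open_ereal_gt' xa)).
Qed.

Lemma near_ptws_lt (nu : fsp) a x : (nu a < x)%E ->
  nbhs nu [set mu : fsp | (mu a < x)%E].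
Proof.
move=> xa; exact: (@ptws_eval _ (\bar R) a nu [set y | (y < x)%E]
  (open_ereal_lt' xa)).
Qed.

(** The lower bounds [c < mu a], for [a] in the finitely generated ideal
    [c' <= nu a], are finitely many conditions; the upper bounds are obtained
    from [avoiding_sequence], applied to the subspaces [c' <= mu a] of the
    spaces [lincomb m]. Rational bounds suffice, so the conditions are
    countably many. *)
Lemma semivaluation_strong_frechet (A : nat -> set fsp) (nu : fsp) :
  finitely_generated (Defs.cst X U) ->
  (forall n, A n `<=` [set mu | semivaluation mu]) ->
  (forall n, closure (A n) nu) ->
  exists y : nat -> fsp, (forall n, A n (y n)) /\ y n @[n --> \oo] --> nu.
Proof.
move=> fg As clA.
have fM := cst_morphism oU.
have nS := finitely_generated_noetherian fM fg.
have [e eS] := finitely_generated_countable fg.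
have ssub : subring [set: sec X U] by [].
have snu : semivaluation nu.
  by apply: semivaluation_closed; apply: closure_subset (clA 0%N); exact: As.
pose r (q : rat) : \bar R := (ratr q)%:E.
have lower (p : rat * rat) : exists2 V, nbhs nu V & forall mu a,
    V mu -> semivaluation mu -> p.1 < p.2 -> (r p.2 <= nu a)%E -> (r p.1 < mu a)%E.
  have [p12|] := ltP p.1 p.2; last by exists setT; [exact: filterT|].
  have [l [lnu ls]] := nS _ (submodule_ge setT (r p.2) snu) (@subsetT _ _).
  exists [set mu : fsp | forall i : 'I_(size l), (r p.1 < mu l`_i)%E].
    apply: (@filter_forall _ _
      (fun (i : 'I_(size l)) => [set mu : fsp | (r p.1 < mu l`_i)%E])
      _ (nbhs_filter nu)) => i.
    have il : l`_i \in l by exact: mem_nth.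
    have pnu : (r p.1 < nu l`_i)%E.
      by apply: lt_le_trans (lnu _ il); rewrite lte_fin ltr_rat.
    exact: near_ptws_gt.
  move=> mu a mul smu _ /ls la.
  apply: (span_min (submodule_gt setT (ratr p.1) smu) _ la) => b /= bl.
  have bs : (index b l < size l)%N by rewrite index_mem.
  by have /= := mul (Ordinal bs); rewrite nth_index.
have /choice[V VP] j : exists V, nbhs nu V /\ forall (p : rat * rat) mu a,
    unpickle j = Some p -> V mu -> semivaluation mu -> p.1 < p.2 ->
    (r p.2 <= nu a)%E -> (r p.1 < mu a)%E.
  case: (unpickle j) => [p|]; last first.
    by exists setT; split=> //; exact: (@filterT _ _ (nbhs_filter nu)).
  by have [V nV VP] := lower p; exists V; split=> // p' mu a [<-]; exact: VP.
(* The indices [j] encode a dimension [m] and two rationals [p < q]. *)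
pose C j a := if @unpickle (nat * (rat * rat))%type j is Some (m, (p, q)) then
  [/\ p < q, lincomb (Defs.cst X U) e m a & (nu a <= r p)%E] else False.
pose B j (mu : fsp) a := if @unpickle (nat * (rat * rat))%type j
  is Some (m, (p, q)) then is_true (r q <= mu a)%E else False.
pose m j := if @unpickle (nat * (rat * rat))%type j is Some (m, _) then m else 0%N.
have clA' n : closure (A n `&` [set mu | forall j : 'I_n.+1, V j mu]) nu.
  move=> W nW; have := clA n (W `&` [set mu | forall j : 'I_n.+1, V j mu]).
  case; last by move=> mu [Amu [Wmu Vmu]]; exists mu.
  apply: (@filterI _ _ (nbhs_filter nu)) => //.
  apply: (@filter_forall _ _ (fun (j : 'I_n.+1) => V j) _ (nbhs_filter nu)) => j.
  by have [] := VP j.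
have [] := @avoiding_sequence _ _ nu C B m [set mu | semivaluation mu] _ _ _ _ clA'.
- move=> j a; rewrite /C /B; case: unpickle => [[m' [p q]]|//] [pq _ nua].
  have nq : (nu a < r q)%E by apply: le_lt_trans nua _; rewrite lte_fin ltr_rat.
  apply: filterS (near_ptws_lt nq) => mu /= muq.
  by apply/negP; rewrite -ltNge.
- move=> j y a; rewrite /C /B /m; case: unpickle => [[m' [p q]]|] sy; last first.
    by move=> /(_ 0%N isT).
  move=> aC aB; apply: (no_triangular_family fM (e := e)
      (W := fun i => [set a | (r q <= y i a)%E])) => //.
    by move=> i im; have [] := aC i im.
  by move=> i; exact: (submodule_ge _ _ (sy i)).
- by move=> n mu [+ _]; exact: As.
move=> y [yA yB]; exists y; split; first by move=> n; have [] := yA n.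
have sy n : semivaluation (y n) by apply: (As n); have [] := yA n.
apply/cvg_ptws => a; apply: ereal_cvg_order => [u ua|u au].
  have [q /andP[uq qa]] := ereal_rat_dense ua.
  have [p /andP[up pq]] := ereal_rat_dense uq.
  exists (pickle (p, q)) => // n /= pn; apply: (lt_trans up).
  have [_ Vn] := yA n; have [_ /(_ (p, q))] := VP (pickle (p, q)).
  apply => //; first exact: pickleK.
  - exact: (Vn (Ordinal (_ : (pickle (p, q) < n.+1)%N))).
  - by rewrite /=; move: pq; rewrite lte_fin ltr_rat.
  - exact: ltW.
have [p /andP[ap pu]] := ereal_rat_dense au.
have [q /andP[pq qu]] := ereal_rat_dense pu.
have [m' _ am] := span_lincomb fM (eS a).
have := yB (pickle (m', (p, q))) a; rewrite /C /B pickleK => yBa.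
apply: filterS (yBa _) => [n /negP|]; first by rewrite -ltNge => /lt_trans; exact.
by split=> //; [move: pq; rewrite lte_fin ltr_rat|exact: ltW].
Qed.

End Semivaluations.

(** * Affine open subsets and their localizations *)

Section Schemes.
Variables (k : fieldType) (X : lrspace k).
Implicit Types (U V W O : set X) (x : X).

Section Restriction.
Variables U V : set X.
Hypotheses (oU : open U) (oV : open V) (VU : V `<=` U).

Lemma resD (s t : sec X U) : res U V (s + t) = res U V s + res U V t.
Proof. by have [[_ ->] _] := res_morphism oU oV VU. Qed.

Lemma res0 : res U V 0 = 0 :> sec X V.
Proof. by have [[-> _] _] := res_morphism oU oV VU. Qed.

Lemma resM (s t : sec X U) : res U V (s * t) = res U V s * res U V t.
Proof. by have [_ [_ ->]] := res_morphism oU oV VU. Qed.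

Lemma res1 : res U V 1 = 1 :> sec X V.
Proof. by have [_ [-> _]] := res_morphism oU oV VU. Qed.

Lemma resX (s : sec X U) n : res U V (s ^+ n) = res U V s ^+ n.
Proof. by elim: n => [|n IHn]; rewrite ?expr0 ?res1 // !exprS resM IHn. Qed.

Lemma resB (s t : sec X U) : res U V (s - t) = res U V s - res U V t.
Proof. by apply/eqP; rewrite eq_sym subr_eq -resD subrK. Qed.

End Restriction.

Lemma nonvanishing_sub U (s : sec X U) : nonvanishing s `<=` U.
Proof. by move=> x [V [_ Vx VU _]]; exact: VU. Qed.

Lemma nonvanishing_open U (s : sec X U) : open (nonvanishing s).
Proof.
rewrite openE => x [V [oV Vx VU st]]; rewrite /interior nbhsE.
by exists V => // y Vy; exists V.
Qed.

Lemma nonvanishing_res U V (s : sec X U) x : open U -> open V -> V `<=` U ->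
  nonvanishing (res U V s) x <-> V x /\ nonvanishing s x.
Proof.
move=> oU oV VU; split=> [[W [oW Wx WV [t]]]|[Vx [W [oW Wx WU [t st]]]]].
  rewrite res_res // => st; split; first exact: WV.
  by exists W; split=> //; [exact: subset_trans VU|exists t].
have oVW := openI oV oW; have VWV := @subIsetl _ V W.
have VWW := @subIsetr _ V W.
exists (V `&` W); split=> //; exists (res W (V `&` W) t).
by rewrite res_res // -(@res_res _ _ U W) // -resM // st res1.
Qed.

Lemma nonvanishingM U (s t : sec X U) x : open U ->
  nonvanishing (s * t) x <-> nonvanishing s x /\ nonvanishing t x.
Proof.
move=> oU; split=> [[V [oV Vx VU [u]]]|[]].
  rewrite resM // => stu; split; exists V; split=> //.
    by exists (res U V t * u); rewrite mulrA.
  by exists (res U V s * u); rewrite mulrCA mulrA.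
move=> [V [oV Vx VU [u su]]] [W [oW Wx WU [v tv]]].
have oVW := openI oV oW; have VWV := @subIsetl _ V W.
have VWW := @subIsetr _ V W; have VWU := subset_trans VWV VU.
exists (V `&` W); split=> //; exists (res V (V `&` W) u * res W (V `&` W) v).
rewrite resM // mulrACA -(@res_res _ _ U V _ s) // -(@res_res _ _ U W _ t) //.
by rewrite -!resM // su tv !res1 // mulr1.
Qed.

Lemma nonvanishing_unit U (s t : sec X U) x : open U -> U x -> s * t = 1 ->
  nonvanishing s x.
Proof.
move=> oU Ux st; exists U; split=> //; exists t; by rewrite res_id.
Qed.

Lemma nonvanishingX U (s : sec X U) n x : open U ->
  nonvanishing s x -> nonvanishing (s ^+ n) x.
Proof.
move=> oU sx; elim: n => [|n IHn]; last by rewrite exprS; apply/nonvanishingM.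
apply: (nonvanishing_unit (t := 1)) => //; last by rewrite mulr1.
exact: nonvanishing_sub sx.
Qed.

Lemma submodule_vanishing U x : open U -> U x ->
  submodule setT [set s : sec X U | ~ nonvanishing s x].
Proof.
move=> oU Ux; split=> /=; first exact: stalk_unit0.
  by move=> s t sx tx /(stalk_unitD oU Ux)[].
by move=> c s _ sx /(nonvanishingM _ _ _ oU)[].
Qed.

Lemma localization U V (s : sec X U) : affine_open U -> V = nonvanishing s ->
  [/\ exists t, res U V s * t = 1,
      (forall b, exists n a, res U V a = b * res U V s ^+ n) &
      (forall a, res U V a = 0 -> exists n, a * s ^+ n = 0)].
Proof. by case=> _ _ _ loc ->; exact: loc. Qed.

(** The axioms of [affine_open] pass to [nonvanishing s] because the prime
    ideals of a localization [A_s] are those of [A] that avoid [s], and because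
    a localization of [A_s] at [a / s ^ n] is the localization of [A] at
    [a s]. *)
Lemma affine_nonvanishing U (s : sec X U) :
  affine_open U -> affine_open (nonvanishing s).
Proof.
move=> aU; have [oU pU bU _] := aU; set W := nonvanishing s.
have oW : open W by exact: nonvanishing_open.
have WU : W `<=` U by exact: nonvanishing_sub.
have [[t st] frac ker] := localization aU (erefl W).
have fracE b : exists n a, b = res U W a * t ^+ n.
  have [n [a aE]] := frac b; exists n, a.
  by rewrite aE -mulrA -exprMn st expr1n mulr1.
have tunit x : W x -> nonvanishing t x.
  by move=> Wx; apply: (nonvanishing_unit (t := res U W s)); rewrite // mulrC.
have nvfrac a n x : nonvanishing (res U W a * t ^+ n) x <-> W x /\ nonvanishing a x.
  rewrite nonvanishingM // nonvanishing_res //; split=> [[]//|[Wx ax]].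
  by split=> //; apply: nonvanishingX => //; exact: tunit.
split=> //.
- move=> P [P0 P1 PD PM Pp].
  have PX b n : P (b * t ^+ n) -> P b.
    move=> /(PM (res U W s ^+ n)); rewrite mulrCA -exprMn st expr1n mulr1.
    exact.
  have [|x [[Ux xP] xuniq]] := pU [set a | P (res U W a)].
    split=> /=.
    + by rewrite res0.
    + by rewrite res1.
    + by move=> a b Pa Pb; rewrite resD //; exact: PD.
    + by move=> a b Pb; rewrite resM //; exact: PM.
    + by move=> a b; rewrite resM //; exact: Pp.
  have xPE a : P (res U W a) <-> ~ nonvanishing a x.
    by have := xP; rewrite predeqE; exact.
  have Wx : W x.
    apply: contrapT => /xPE Ps; apply: P1; rewrite -st mulrC; exact: PM.
  exists x; split.
    split=> //; apply/seteqP; split=> b; have [n [a ->]] := fracE b => /=.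
      by move=> /PX/xPE ax /nvfrac[].
    move=> nb; rewrite mulrC; apply: PM; apply/xPE => ax; apply: nb.
    exact/nvfrac.
  move=> y [Wy yP]; apply: xuniq; split; first exact: WU.
  apply/seteqP; split=> a /=; rewrite yP /= nonvanishing_res //.
    by move=> na ay; apply: na.
  by move=> na [].
- move=> V x oV VW Vx.
  have [|u [ux uV]] := bU V x oV _ Vx; first exact: subset_trans WU.
  exists (res U W u); split; first by apply/nonvanishing_res => //; split=> //; exact: VW.
  by move=> y /nonvanishing_res[]// _ /uV.
- move=> s1 /=; set V := nonvanishing s1.
  have [n [a s1E]] := frac s1.
  have VE : V = nonvanishing (a * s).
    apply/seteqP; split=> x.
      move=> s1x; have Wx := nonvanishing_sub s1x.
      apply/nonvanishingM => //; split=> //.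
      suff : nonvanishing (res U W a) x by case/nonvanishing_res.
      rewrite s1E; apply/nonvanishingM => //; split=> //.
      by apply: nonvanishingX => //; apply: (nonvanishing_unit _ _ st).
    move=> /nonvanishingM[] // ax Wx.
    have : nonvanishing (res U W a) x by exact/nonvanishing_res.
    by rewrite s1E => /nonvanishingM[].
  have VW : V `<=` W by exact: nonvanishing_sub.
  have oV : open V by exact: nonvanishing_open.
  have VU : V `<=` U by exact: subset_trans WU.
  have [[u asu] fracV kerV] := localization aU VE.
  have resas : res U V (a * s) = res W V s1 * res U V s ^+ n.+1.
    rewrite resM // -(@res_res _ _ U W V a) // s1E resM // resX //.
    by rewrite res_res // -mulrA -exprSr.
  have resst : res U V s * res W V t = 1.
    by rewrite -(@res_res _ _ U W V s) // -resM // st res1.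
  split.
  + by exists (res U V s ^+ n.+1 * u); rewrite mulrA -resas.
  + move=> b; have [m [a' a'E]] := fracV b.
    exists m, (res U W a' * t ^+ (n.+1 * m)).
    rewrite resM // res_res // a'E resas resX // exprMn -exprM -!mulrA.
    by rewrite -exprMn resst expr1n mulr1.
  + move=> b; have [m [a' ->]] := fracE b; rewrite resM // res_res // => a't0.
    have [|N a'N] := kerV a'.
      have -> : res U V a' = res U V a' * res W V (t ^+ m) * res U V s ^+ m.
        by rewrite -mulrA resX // -exprMn (mulrC (res W V t)) resst expr1n mulr1.
      by rewrite a't0 mul0r.
    exists N; have := congr1 (res U W) a'N.
    rewrite res0 // resM // resX // resM // s1E -mulrA -exprSr => a'z.
    have -> : res U W a' * t ^+ m * s1 ^+ N =
        res U W a' * (s1 * res U W s ^+ n.+1) ^+ N * (t ^+ (n.+1 * N) * t ^+ m).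
      rewrite [in RHS]exprMn -exprM -!mulrA; congr (_ * _).
      by rewrite mulrC; congr (_ * _); rewrite mulrA -exprMn st expr1n mul1r.
    by rewrite a'z mul0r.
Qed.

Lemma fg_nonvanishing U (s : sec X U) :
  affine_open U -> fg_algebra U -> fg_algebra (nonvanishing s).
Proof.
move=> aU [g gP]; have [oU _ _ _] := aU; set W := nonvanishing s.
have oW : open W by exact: nonvanishing_open.
have WU : W `<=` U by exact: nonvanishing_sub.
have [[t st] frac _] := localization aU (erefl W).
exists (t :: map (res U W) g) => S Sc Sg SD SM.
have SU : [set a | S (res U W a)] = setT.
  apply: gP => /= [c|a ag|a b Sa Sb|a b Sa Sb].
  - by rewrite res_cst.
  - by apply: Sg; rewrite inE map_f ?orbT.
  - by rewrite resD //; exact: SD.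
  - by rewrite resM //; exact: SM.
rewrite -subTset => b _; have [n [a aE]] := frac b.
have -> : b = res U W a * t ^+ n.
  by rewrite aE -mulrA -exprMn st expr1n mulr1.
apply: (SM); first by have : [set: sec X U] a by []; rewrite -SU.
elim: n {aE} => [|n IHn]; last by rewrite exprS; apply: SM => //; exact/Sg/mem_head.
by rewrite expr0; have [_ [<- _]] := cst_morphism oW; exact: Sc.
Qed.

Definition affine_fg W := affine_open W /\ fg_algebra W.

Definition finite_affine_cover O (C : set (set X)) :=
  [/\ finite_set C, forall W, C W -> affine_fg W,
      forall W, C W -> W `<=` O & O `<=` \bigcup_(W in C) W].

(** The sections that vanish at a point form an ideal, so by noetherianity
    finitely many of the basic open sets [nonvanishing s] contained in [O]
    suffice to cover [O]. *)
Lemma finite_affine_coverP O : finite_type X -> open O ->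
  exists C, finite_affine_cover O C.
Proof.
move=> [n [V [aV VT]]] oO.
have /choice[C CP] (j : 'I_n) : exists C, [/\ finite_set C,
    forall W, C W -> affine_fg W, forall W, C W -> W `<=` O &
    O `&` V j `<=` \bigcup_(W in C) W].
  have [aVj fgj] := aV j; have [oV _ bV _] := aVj.
  have nV := finitely_generated_noetherian (cst_morphism oV) fgj.
  pose S := [set s : sec X (V j) | nonvanishing s `<=` O].
  have sT : subring [set: sec X (V j)] by [].
  have [l [lS Sl]] := noetherian_span nV sT (@subsetT _ S).
  exists [set nonvanishing s | s in [set` l]]; split.
  - exact/finite_image/finite_seq.
  - move=> _ [s _ <-]; split; [exact: affine_nonvanishing|exact: fg_nonvanishing].
  - by move=> _ [s /lS sS <-].
  - move=> x [Ox Vx].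
    have [||s [sx sO]] := bV (O `&` V j) x _ _ (conj Ox Vx).
    + exact: openI.
    + exact: subIsetr.
    apply: contrapT => nx.
    have lx : [set` l] `<=` [set s : sec X (V j) | ~ nonvanishing s x].
      by move=> u ul ux; apply: nx; exists (nonvanishing u) => //; exists u.
    have : S s by move=> y /sO[].
    move=> /Sl/(span_min (submodule_vanishing oV Vx) lx); exact.
exists (\bigcup_j C j); split.
- by apply: bigcup_finite => // j _; have [] := CP j.
- by move=> W [j _]; have [_ + _ _] := CP j; exact.
- by move=> W [j _]; have [_ _ + _] := CP j; exact.
- move=> x Ox; have : [set: X] x by []; rewrite -VT => -[j _ Vx].
  have [_ _ _ /(_ x (conj Ox Vx))[W CW Wx]] := CP j.
  by exists W => //; exists j.
Qed.

(** * Centers and extensions of semivaluations *)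

Section Centers.
Variable R : realType.

(** The value [0] means that the section is invertible at [x], so the prime ideal
    of the sections with positive value is the ideal of [x]. *)
Definition centered U (nu : sec X U -> \bar R) x :=
  U x /\ forall a, nonvanishing a x <-> nu a = 0%E.

Lemma center_exists U (nu : sec X U -> \bar R) :
  affine_open U -> semivaluation nu -> exists x, centered nu x.
Proof.
move=> [oU pU _ _] snu; have [p M mn z c] := snu.
have [|x [[Ux xP] _]] := pU [set a | (0 < nu a)%E].
  split=> /=.
  - by rewrite z ltry.
  - by rewrite semivaluation1 // ltxx.
  - by move=> a b pa pb; apply: lt_le_trans (mn a b); rewrite lt_min pa.
  - by move=> a b pb; rewrite M; apply: lt_le_trans pb _; rewrite leeDr.
  - move=> a b; rewrite M !lt0e !p !andbT padde_eq0 // negb_and.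
    by move=> /andP[/orP[] ? _]; [left|right].
exists x; split=> // a; have := xP; rewrite predeqE => /(_ a) /= [xa ax].
split=> [sax|na].
  apply/eqP; apply: contrapT => /negP na; apply: xa => //.
  by rewrite lt0e na p.
by apply: contrapT => /ax; rewrite na ltxx.
Qed.

Lemma center_unique U (nu : sec X U -> \bar R) x y :
  affine_open U -> semivaluation nu -> centered nu x -> centered nu y -> x = y.
Proof.
move=> [oU pU _ _] snu [Ux xP] [Uy yP].
have [|z [_ zP]] := pU [set s | ~ nonvanishing s x].
  have [V0 VD VM] := submodule_vanishing oU Ux; split=> //.
  - by move=> /=; apply; apply: (nonvanishing_unit (t := 1)); rewrite // mulr1.
  - by move=> a b; exact: VM.
  - move=> a b /= nab; apply: contrapT => /not_orP[/contrapT ax /contrapT bx].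
    by apply: nab; apply/nonvanishingM.
rewrite -(zP x) // -(zP y) //; split=> //; apply/seteqP.
by split=> s /=; rewrite xP yP.
Qed.

(** A semivaluation whose center lies in [O] vanishes on some section [s] with
    [nonvanishing s] in [O], and it extends to the fractions [a / s ^ n]. *)
Lemma extend_semivaluation U O (nu : {ptws sec X U -> \bar R}) x :
  affine_open U -> semivaluation nu -> centered nu x -> open O -> O x ->
  O `<=` U ->
  exists mu : {ptws sec X O -> \bar R},
    semivaluation mu /\ forall a, mu (res U O a) = nu a.
Proof.
move=> aU snu [Ux xP] oO Ox OU; have [oU _ bU _] := aU.
have [s [sx sO]] := bU O x oO OU Ox; set W := nonvanishing s.
have oW : open W by exact: nonvanishing_open.
have WU : W `<=` U by exact: nonvanishing_sub.
have [_ frac ker] := localization aU (erefl W).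
have [p M mn z c] := snu; have s0 : nu s = 0%E by exact/xP.
have Ms a n : nu (a * s ^+ n) = nu a by rewrite M semivaluationX ?adde0.
(* The value of a fraction [a / s ^ n] is that of its numerator, because
   [nu s = 0]. *)
have key a b m n : res U W a * res U W s ^+ m = res U W b * res U W s ^+ n ->
    nu a = nu b.
  rewrite -!resX // -!resM // => /eqP; rewrite -subr_eq0 -resB // => /eqP.
  move=> /ker[N]; rewrite mulrBl => /eqP; rewrite subr_eq0 -!mulrA -!exprD.
  by move=> /eqP /(congr1 nu); rewrite !Ms.
have /choice[f fP] b : exists q : nat * sec X U,
    res U W q.2 = b * res U W s ^+ q.1.
  by have [n [a aE]] := frac b; exists (n, a).
pose mu b := nu (f b).2.
have muP b a n : res U W a = b * res U W s ^+ n -> mu b = nu a.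
  move=> aE; apply: (key _ _ n (f b).1); rewrite fP aE -!mulrA; congr (_ * _).
  by rewrite mulrC.
have smu : semivaluation (mu : {ptws sec X W -> \bar R}).
  split.
  - by move=> a; exact: p.
  - move=> a b; rewrite [in RHS]/mu -M; apply: (muP _ _ ((f a).1 + (f b).1)%N).
    by rewrite resM // !fP exprD mulrACA.
  - move=> a b; rewrite (muP (a + b) ((f a).2 * s ^+ (f b).1 +
        (f b).2 * s ^+ (f a).1) ((f a).1 + (f b).1)%N).
      by apply: le_trans (mn _ _); rewrite !Ms.
    by rewrite resD // !resM // !resX // !fP -!mulrA -!exprD mulrDl
      [((f b).1 + _)%N]addnC.
  - by rewrite (muP 0 0 0%N) ?z // res0 // mul0r.
  - move=> d d0; rewrite (muP _ (Defs.cst X U d) 0%N) ?c //.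
    by rewrite res_cst // expr0 mulr1.
have [q N mq y e] := smu.
exists (fun b => mu (res O W b)); split; last first.
  by move=> a; rewrite res_res // (muP _ a 0%N) // expr0 mulr1.
split.
- by move=> a; exact: q.
- by move=> a b; rewrite resM.
- by move=> a b; rewrite resD.
- by rewrite res0.
- by move=> d d0; rewrite res_cst ?e.
Qed.

(** When [W] is affine, a section of [W] multiplied by a power of some [s] of
    value [0] comes from [U]. *)
Lemma extension_unique U W (nu : {ptws sec X U -> \bar R})
    (mu mu' : {ptws sec X W -> \bar R}) x :
  affine_open U -> semivaluation nu -> centered nu x ->
  affine_open W -> W x -> W `<=` U ->
  semivaluation mu -> semivaluation mu' ->
  (forall a, mu (res U W a) = nu a) -> (forall a, mu' (res U W a) = nu a) ->
  forall b, mu b = mu' b.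
Proof.
move=> aU snu [Ux xP] aW Wx WU smu smu' muE mu'E b.
have [oU _ bU _] := aU; have [oW _ _ _] := aW.
have [s [sx sW]] := bU W x oW WU Wx; set V := nonvanishing s.
have oV : open V by exact: nonvanishing_open.
have VU : V `<=` U by exact: nonvanishing_sub.
have VE : V = nonvanishing (res U W s).
  apply/seteqP; split=> y.
    by move=> sy; apply/nonvanishing_res => //; split=> //; exact: sW.
  by move=> /nonvanishing_res[].
have [_ fracU _] := localization aU (erefl V).
have [_ _ kerW] := localization aW VE.
have [n [a aE]] := fracU (res W V b).
have [|N] := kerW (res U W a - b * res U W s ^+ n).
  by rewrite resB // resM // resX // !res_res // aE subrr.
move/eqP; rewrite mulrBl subr_eq0 -mulrA -exprD => /eqP abE.
have vanish (rho : {ptws sec X W -> \bar R}) : semivaluation rho ->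
    (forall a, rho (res U W a) = nu a) -> rho b = nu a.
  move=> srho rhoE; have rs m : rho (res U W s ^+ m) = 0%E.
    by apply: semivaluationX => //; rewrite rhoE; exact/xP.
  have := congr1 rho abE; have [_ rM _ _ _] := srho.
  by rewrite !rM !rs !adde0 rhoE.
by rewrite !vanish.
Qed.

Lemma restrict_semivaluation U W (mu : {ptws sec X W -> \bar R}) :
  open U -> open W -> W `<=` U -> semivaluation mu ->
  semivaluation ((fun a => mu (res U W a)) : {ptws sec X U -> \bar R}).
Proof.
move=> oU oW WU [p M mn z c]; split.
- by move=> a; exact: p.
- by move=> a b; rewrite resM.
- by move=> a b; rewrite resD.
- by rewrite res0.
- by move=> d d0; rewrite res_cst ?c.
Qed.

Lemma restrict_center U W (nu : {ptws sec X U -> \bar R})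
    (mu : {ptws sec X W -> \bar R}) x :
  open U -> open W -> W `<=` U -> (forall a, nu a = mu (res U W a)) ->
  centered mu x -> centered nu x.
Proof.
move=> oU oW WU nuE [Wx xP]; split; first exact: WU.
move=> a; rewrite nuE -xP nonvanishing_res //; split=> [ax|[]] //.
Qed.

(** Two semivaluations that are restrictions of one on [W]; for the points of
    two charts, this is the relation along which they are patched. *)
Definition linked W U V (nu : {ptws sec X U -> \bar R})
    (rho : {ptws sec X V -> \bar R}) :=
  [/\ W `<=` U, W `<=` V & exists mu : {ptws sec X W -> \bar R},
    [/\ semivaluation mu, forall a, nu a = mu (res U W a) &
        forall a, rho a = mu (res V W a)]].

(** Both semivaluations that link to [nu2] have the center of [nu2] as center;
    on an affine neighborhood of this point their extensions agree, as
    extensions of [nu2]. *)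
Lemma linked_trans U1 U2 U3 W W' (nu1 : {ptws sec X U1 -> \bar R})
    (nu2 : {ptws sec X U2 -> \bar R}) (nu3 : {ptws sec X U3 -> \bar R}) :
  open U1 -> affine_open U2 -> open U3 -> affine_open W -> affine_open W' ->
  linked W nu1 nu2 -> linked W' nu2 nu3 ->
  exists W'', affine_open W'' /\ linked W'' nu1 nu3.
Proof.
move=> oU1 aU2 oU3 aW aW' [WU1 WU2 [mu [smu mu1 mu2]]].
move=> [WU2' WU3 [mu' [smu' mu2' mu3]]].
have [oU2 _ _ _] := aU2; have [oW _ bW _] := aW; have [oW' _ _ _] := aW'.
have snu2 : semivaluation nu2.
  have -> : nu2 = fun a => mu (res U2 W a) by apply/funext.
  exact: restrict_semivaluation.
have [x cx] := center_exists aW smu; have [y cy] := center_exists aW' smu'.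
have cx2 := restrict_center oU2 oW WU2 mu2 cx.
have cy2 := restrict_center oU2 oW' WU2' mu2' cy.
have yx : y = x by exact: center_unique cy2 cx2.
rewrite {}yx {y cy2} in cy; have [Wx _] := cx; have [W'x _] := cy.
have [||s [sx sW]] := bW (W `&` W') x _ _ (conj Wx W'x).
- exact: openI.
- exact: subIsetl.
pose V := nonvanishing s; have aV : affine_open V by exact: affine_nonvanishing.
have [oV _ _ _] := aV; have VW : V `<=` W by move=> z /sW[].
have VW' : V `<=` W' by move=> z /sW[].
have [rho [srho rhoE]] := extend_semivaluation aW smu cx oV sx VW.
have [rho' [srho' rho'E]] := extend_semivaluation aW' smu' cy oV sx VW'.
have VU2 : V `<=` U2 by exact: subset_trans WU2.
have rr' : forall b, rho b = rho' b.
  apply: (extension_unique aU2 snu2 cx2 aV sx VU2 srho srho') => a.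
    by rewrite -(@res_res _ _ U2 W V) // rhoE mu2.
  by rewrite -(@res_res _ _ U2 W' V) // rho'E mu2'.
exists V; split=> //; split; [exact: subset_trans WU1|exact: subset_trans WU3|].
exists rho; split=> // a.
  by rewrite mu1 -rhoE res_res.
by rewrite mu3 -rho'E res_res // rr'.
Qed.

(** The member of the cover that contains the center can replace [W]. *)
Lemma linked_cover U V W (C : set (set X)) (nu : {ptws sec X U -> \bar R})
    (rho : {ptws sec X V -> \bar R}) :
  open U -> open V -> affine_open W -> linked W nu rho ->
  finite_affine_cover (U `&` V) C -> exists2 W', C W' & linked W' nu rho.
Proof.
move=> oU oV aW [WU WV [mu [smu nuE rhoE]]] [_ aC CUV UVC].
have [oW _ _ _] := aW; have [x cx] := center_exists aW smu.
have [Wx _] := cx; have [W' CW' W'x] := UVC x (conj (WU x Wx) (WV x Wx)).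
have [[oW' _ _ _] _] := aC _ CW'; have oI := openI oW oW'.
have [mu1 [smu1 mu1E]] :=
  extend_semivaluation aW smu cx oI (conj Wx W'x) (@subIsetl _ W W').
have sub1 := @subIsetl _ W W'; have sub2 := @subIsetr _ W W'.
have W'U : W' `<=` U by move=> z /(CUV _ CW')[].
have W'V : W' `<=` V by move=> z /(CUV _ CW')[].
exists W' => //; split=> //; exists (fun a => mu1 (res W' (W `&` W') a)).
split; first exact: restrict_semivaluation.
  by move=> a; rewrite nuE -mu1E !res_res.
by move=> a; rewrite rhoE -mu1E !res_res.
Qed.

End Centers.
End Schemes.

(** * The glued fiber *)

Lemma finite_frequently (I : choiceType) (C : set I) (P : I -> nat -> Prop) :
  finite_set C -> (forall n, exists2 i, C i & P i n) ->
  exists2 i, C i & forall N, exists2 n, (N <= n)%N & P i n.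
Proof.
move=> /finite_seqP[s ->] sP; have [i0 _ _] := sP 0%N.
apply: contrapT => nP.
have : \forall n \near \oo, forall a : 'I_(size s), ~ P (nth i0 s a) n.
  apply: filter_forall => a; apply: contrapT => naP; apply: nP.
  exists (nth i0 s a); first exact: mem_nth.
  move=> N; apply: contrapT => nN; apply: naP; exists N => // n /= Nn Pan.
  by apply: nN; exists n.
move=> [N _ /(_ N (leqnn N)) nPN]; have [i /= si PiN] := sP N.
have ii : (index i s < size s)%N by rewrite index_mem.
by apply: (nPN (Ordinal ii)); rewrite /= nth_index.
Qed.

Lemma subtype_compact (T : topologicalType) (S : set T) :
  compact S -> compact [set: S].
Proof.
move=> cS F FF _; have [|p [Sp Fp]] := cS (set_val @ F) (fmap_proper_filter _ FF).
  by apply: (@filterS _ F _ setT) => [x _|]; [exact: set_valP|exact: filterT].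
exists (exist _ p (mem_set Sp)); split=> // B V FB [_ [[G oG <-] /= Gp GV]].
have [||_ [[x Bx <-] Gx]] := Fp (set_val @` B) G.
- by apply: (@filterS _ F _ B) => // x Bx; exists x.
- exact: open_nbhs_nbhs.
by exists x; split=> //; exact: GV.
Qed.

Section GenericFiber.
Variables (R : realType) (k : fieldType) (X D : lrspace k) (i : mor D X).
Variable A : atlas i.
Hypothesis ftX : finite_type X.

Local Notation Q := (normalized_generic_fiber R A).
Local Notation fib := (@local_fiber R k X D i A).
Implicit Types (j l : 'I_(atlas_size A)) (W : set X).

Definition glued_point j (nu : fib j) : Q := \pi_Q%qT (existT fib j nu).

Lemma chart_affine j : affine_open (chart A j).
Proof. by have [] := equationP j. Qed.

Lemma chart_open j : open (chart A j).
Proof. by have [] := chart_affine j. Qed.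

Lemma fiberP j (nu : fib j) :
  semivaluation (set_val nu) /\ set_val nu (equation A j) = 1%E.
Proof. by have [[? _] ?] := set_valP nu. Qed.

Lemma fiber_exists j (nu : {ptws sec X (chart A j) -> \bar R}) :
  semivaluation nu -> nu (equation A j) = 1%E ->
  exists x : fib j, set_val x = nu.
Proof.
move=> snu nu1; have nuS : normalized_affine_fiber R (equation A j) nu.
  by split=> //; split=> //; rewrite nu1 lte01 ltry.
by exists (exist _ nu (mem_set nuS)).
Qed.

Lemma glued_point_surj (q : Q) : exists j (nu : fib j), q = glued_point nu.
Proof.
rewrite -[q]reprK; case: (repr q) => j nu; by exists j, nu.
Qed.

Lemma glued_point_cvg j (y : nat -> fib j) (z : fib j) :
  (forall a, set_val (y n) a @[n --> \oo] --> set_val z a) ->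
  glued_point (y n) @[n --> \oo] --> glued_point z.
Proof.
move=> yz; have {}yz : y n @[n --> \oo] --> z.
  by apply/(cvg_initial set_val); apply/cvg_ptws.
have {}yz : (existT fib j (y n) : disjoint_fibers R A) @[n --> \oo] -->
    (existT fib j z : disjoint_fibers R A).
  by apply: cvg_comp yz _; exact: existT_continuous.
by apply: cvg_comp yz _; exact: pi_continuous.
Qed.

(** By [linked_trans] the relation along which the charts are patched is already
    transitive, so it coincides with the equivalence relation that it generates. *)
Lemma glued_point_eq j l (nu : fib j) (rho : fib l) : glued_point nu = glued_point rho <->
  exists W, affine_open W /\ linked W (set_val nu) (set_val rho).
Proof.
pose lnk (x y : disjoint_fibers R A) := exists W,
  affine_open W /\ linked W (set_val (tagged x)) (set_val (tagged y)).
have lnk_patched x y : lnk x y <-> patched x y.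
  split=> [[W [aW [Wx Wy [mu [smu xE yE]]]]]|[W [aW Wx Wy [mu [smu _] [xE yE]]]]].
    exists W; split=> //; exists mu => //; split=> //.
    by rewrite -xE; have [_ ->] := fiberP (tagged x); rewrite lte01 ltry.
  by exists W; split=> //; split=> //; exists mu.
have rst_lnk x y : Relation_Operators.clos_refl_sym_trans _ (@patched R k X D i A) x y ->
    lnk x y.
  elim=> {x y} [x y /lnk_patched //|x|x y _|x y z _ + _].
  - exists (chart A (tag x)); split; first exact: chart_affine.
    split=> //; exists (set_val (tagged x)).
    have [sx _] := fiberP (tagged x); have ox := chart_open (tag x).
    by split=> // a; rewrite res_id.
  - move=> [W [aW [Wx Wy [mu [smu xE yE]]]]].
    by exists W; split=> //; split=> //; exists mu.
  - move=> [W [aW xy]] [W' [aW' yz]].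
    have ox := chart_open (tag x); have oz := chart_open (tag z).
    exact: (linked_trans ox (chart_affine (tag y)) oz aW aW' xy yz).
split=> [/(introT (eqmodP (glue_equiv R A) _ _))|lnr].
  by move=> /asboolP; exact: rst_lnk.
apply: (elimT (eqmodP (glue_equiv R A) _ _)); apply/asboolP.
by apply: Relation_Operators.rst_step; apply: (lnk_patched _ _).1.
Qed.

Definition restrict U W (mu : {ptws sec X W -> \bar R}) :
  {ptws sec X U -> \bar R} := fun a => mu (res U W a).

Lemma restrict_continuous U W : continuous (@restrict U W).
Proof.
move=> mu; have FF : Filter (@restrict U W @ nbhs mu) by exact: fmap_filter.
apply: (@cvg_ptws (sec X U) (\bar R) _ (restrict mu) FF).2 => a.
exact: (@ptws_eval (sec X W) (\bar R) (res U W a) mu).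
Qed.

Lemma restrict_compact U W (Z : set {ptws sec X W -> \bar R}) :
  compact Z -> compact (@restrict U W @` Z).
Proof.
apply: continuous_compact; apply: continuous_subspaceT.
exact: restrict_continuous.
Qed.

Definition fiber_over j W : set {ptws sec X W -> \bar R} :=
  normalized [set res (chart A j) W (equation A j)].

Arguments fiber_over j W : clear implicits.

Definition glued_image j W (Z : set {ptws sec X W -> \bar R}) : set Q :=
  [set q | exists2 mu, Z mu &
    exists2 nu : fib j, set_val nu = restrict mu & q = glued_point nu].

Lemma restrict_fiber j W mu : open W -> W `<=` chart A j -> fiber_over j W mu ->
  exists nu : fib j, set_val nu = restrict mu.
Proof.
move=> oW Wj [smu mu1]; apply: fiber_exists; last exact: mu1.
by apply: restrict_semivaluation => //; exact: chart_open.
Qed.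

(** In every chart, the points identified with a point of the image form a
    finite union of images of compact sets, one for each member of a finite
    affine cover of the intersection of the two charts. *)
Lemma glued_image_closed j W Z : affine_open W -> W `<=` chart A j ->
  closed Z -> Z `<=` fiber_over j W -> closed (glued_image j Z).
Proof.
move=> [oW _ _ _] Wj cZ ZW.
have oj := chart_open j.
have cptZ : compact Z.
  by apply: subclosed_compact ZW => //; exact: normalized_compact.
suff cl l : closed [set rho : fib l | glued_image j Z (glued_point rho)].
  rewrite -openC; apply/sigT_openP => l.
  exact: (closed_openC (cl l)).
have ol := chart_open l.
have [C Ccov] := finite_affine_coverP ftX (openI oj ol); have [fC aC CI _] := Ccov.
pose T W' := @restrict (chart A l) W' @` (normalized
  [set res (chart A j) W' (equation A j); res (chart A l) W' (equation A l)]
  `&` @restrict (chart A j) W' @^-1` (@restrict (chart A j) W @` Z)).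
have -> : [set rho : fib l | glued_image j Z (glued_point rho)] =
    set_val @^-1` (\bigcup_(W' in C) T W').
  apply/seteqP; split=> rho /=.
    move=> [mu Zmu [nu nuE /esym/glued_point_eq[W0 [aW0 lnk]]]].
    have [W' CW' [W'j W'l [mu' [smu' nu' rho']]]] := linked_cover oj ol aW0 lnk Ccov.
    have [_ nu1] := fiberP nu; have [_ rho1] := fiberP rho.
    exists W' => //; exists mu'; last by apply/funext => a; rewrite rho'.
    split; first by split=> // f [->|->]; rewrite -?nu' -?rho'.
    by exists mu => //; rewrite -nuE; apply/funext => a; rewrite nu'.
  move=> [W' CW' [mu' [[smu' _] [mu Zmu muE]] rhoE]].
  have [nu nuE] := restrict_fiber oW Wj (ZW _ Zmu).
  exists mu => //; exists nu => //; apply/esym/glued_point_eq; exists W'.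
  have [[aW' _] W'I] := (aC _ CW', CI _ CW').
  split=> //; split=> [x /W'I[]//|x /W'I[]//|]; exists mu'; split=> // a.
    by rewrite nuE muE.
  by rewrite -rhoE.
apply: closed_comp; first by move=> x _; exact: initial_continuous.
apply: closed_bigcup => // W' CW'; have [[oW' _ _ _] _] := aC _ CW'.
apply: compact_closed; first exact: ptws_hausdorff.
apply: restrict_compact; apply: compact_closedI.
  exact: normalized_compact.
apply: closed_comp; first by move=> x _; exact: restrict_continuous.
apply: compact_closed; [exact: ptws_hausdorff|exact: restrict_compact].
Qed.

Lemma chart_coverings : exists C : 'I_(atlas_size A) -> set (set X),
  forall j, finite_affine_cover (chart A j) (C j).
Proof.
suff /choice[C CP] : forall j, exists C, finite_affine_cover (chart A j) C.
  by exists C.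
by move=> j; apply: finite_affine_coverP => //; exact: chart_open.
Qed.

Definition lifts j W (B : set Q) : set {ptws sec X W -> \bar R} :=
  [set mu | fiber_over j W mu /\
    exists2 nu : fib j, set_val nu = restrict mu & B (glued_point nu)].
Arguments lifts j W B : clear implicits.

Lemma closure_lifts j W B : closure (lifts j W B) `<=` fiber_over j W.
Proof.
have /closure_id -> : closed (fiber_over j W).
  by apply: compact_closed; [exact: ptws_hausdorff|exact: normalized_compact].
by apply: closure_subset => mu [].
Qed.

Section Covering.
Variable C : 'I_(atlas_size A) -> set (set X).
Hypothesis covC : forall j, finite_affine_cover (chart A j) (C j).

(* The finitely many affine open sets in use, with the chart of each of them. *)
Let pieces : set ('I_(atlas_size A) * set X) := [set p | C p.1 p.2].

Lemma finite_pieces : finite_set pieces.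
Proof.
have -> : pieces = \bigcup_j ((fun W => (j, W)) @` C j).
  apply/seteqP; split=> [[j W] CjW|[j W] [l _ [W' CW' [<- <-]]]//].
  by exists j => //; exists W.
apply: bigcup_finite => // j _; apply: finite_image.
by have [] := covC j.
Qed.

Lemma pieceP p : pieces p ->
  [/\ open p.2, affine_open p.2, fg_algebra p.2 & p.2 `<=` chart A p.1].
Proof.
move=> Cp; have [_ aC Cj _] := covC p.1; have [aW fgW] := aC _ Cp.
by have [oW _ _ _] := aW; split=> //; exact: Cj.
Qed.

Lemma glued_point_piece j (nu : fib j) : exists2 W, C j W &
  exists2 mu, fiber_over j W mu & set_val nu = restrict mu.
Proof.
have [snu nu1] := fiberP nu; have [x cx] := center_exists (chart_affine j) snu.
have [Ux _] := cx; have [_ _ _ /(_ x Ux)[W CW Wx]] := covC j.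
have [oW _ _ Wj] := pieceP (CW : pieces (j, W)).
have [mu [smu muE]] := extend_semivaluation (chart_affine j) snu cx oW Wx Wj.
exists W => //; exists mu; first by split=> // f ->; rewrite muE.
by apply/funext => a; rewrite -muE.
Qed.

(** The images of the closures of the lifts of [B] form a finite union of
    closed sets containing [B]. *)
Lemma closure_image (B : set Q) :
  closure B `<=` \bigcup_(p in pieces) glued_image p.1 (closure (lifts p.1 p.2 B)).
Proof.
set U := \bigcup_(p in _) _; suff cU : closed U.
  rewrite (closure_id U).1 //; apply: closure_subset => q Bq.
  have [j [nu qE]] := glued_point_surj q.
  have [W CW [mu muW nuE]] := glued_point_piece nu.
  exists (j, W) => //; exists mu; last by exists nu.
  by apply: subset_closure; split=> //; exists nu; rewrite -?qE.
apply: closed_bigcup => [|p /pieceP[_ aW _ Wj]]; first exact: finite_pieces.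
apply: glued_image_closed => //; [exact: closed_closure|exact: closure_lifts].
Qed.

Lemma lifts_sequence j W (B : nat -> set Q) mu : pieces (j, W) ->
  (forall n, closure (lifts j W (B n)) mu) ->
  exists y : nat -> Q, (forall n, B n (y n)) /\
    forall nu : fib j, set_val nu = restrict mu -> y n @[n --> \oo] --> glued_point nu.
Proof.
move=> pjW clB; have [oW _ fgW _] := pieceP pjW.
have [|z [zB zmu]] := semivaluation_strong_frechet oW fgW _ clB.
  by move=> n rho [[]].
have /choice[nu nuP] n : exists nu : fib j,
    set_val nu = restrict (z n) /\ B n (glued_point nu).
  by have [_ [nu nuE Bnu]] := zB n; exists nu.
exists (fun n => glued_point (nu n)); split=> [n|rho rhoE]; first by have [] := nuP n.
apply: glued_point_cvg => a; rewrite rhoE /restrict.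
have -> : (fun n => set_val (nu n) a) = (fun n => z n (res (chart A j) W a)).
  by apply/funext => n; have [-> _] := nuP n.
exact: (cvg_comp _ _ zmu (@ptws_eval (sec X W) (\bar R) (res (chart A j) W a) mu)).
Qed.

End Covering.

Lemma fiber_compact : compact [set: Q].
Proof.
have -> : [set: Q] = \pi_Q%qT @` [set: disjoint_fibers R A].
  by apply/seteqP; split=> // q _; exists (repr q) => //; exact: reprK.
apply: continuous_compact.
  by apply: continuous_subspaceT; exact: pi_continuous.
apply: sigT_compact => [|j]; first exact: finite_finset.
apply: subtype_compact.
have -> : normalized_affine_fiber R (equation A j) =
    normalized [set equation A j].
  apply/seteqP; split=> nu; first by move=> [[snu _] nu1]; split=> // f ->.
  move=> [snu /(_ _ erefl) nu1]; split=> //; split=> //.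
  by rewrite nu1 lte01 ltry.
apply: normalized_compact.
Qed.

Lemma fiber_frechet (B : set Q) q : closure B q ->
  exists y : nat -> Q, (forall n, B (y n)) /\ y n @[n --> \oo] --> q.
Proof.
have [C covC] := chart_coverings.
move=> /(closure_image covC)[[j W] pjW [mu clmu [nu nuE ->]]].
have [y [yB ynu]] := lifts_sequence covC pjW (fun _ : nat => clmu).
by exists y; split=> //; exact: ynu.
Qed.

Lemma fiber_angelic : angelic Q.
Proof.
split=> [B _|B q]; last exact: fiber_frechet.
rewrite precompactE; apply: subclosed_compact (fiber_compact) _ => //.
exact: closed_closure.
Qed.

Lemma fiber_sequentially_compact : sequentially_compact Q.
Proof.
move=> u; have [C covC] := chart_coverings.
pose P (p : 'I_(atlas_size A) * set X) n :=
  lifts p.1 p.2 [set u n] !=set0.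
have [|[j W] pjW jWu] := finite_frequently (P := P) (finite_pieces covC).
  move=> n; have [j [nu unE]] := glued_point_surj (u n).
  have [W CW [mu muW nuE]] := glued_point_piece covC nu.
  by exists (j, W) => //; exists mu; split=> //; exists nu.
pose B N := [set u n | n in [set n | (N <= n)%N]].
have TB N : lifts j W (B N) !=set0.
  have [n Nn [mu [muW [nu nuE un]]]] := jWu N.
  by exists mu; split=> //; exists nu => //; exists n.
(* A cluster point common to the lifts of all the tails of the sequence. *)
have [mu muB] : exists mu, forall N, closure (lifts j W (B N)) mu.
  have /choice[z zB] N : exists mu, lifts j W (B N) mu by exact: TB.
  have cW : compact (fiber_over j W) by exact: normalized_compact.
  have [|mu [_ clmu]] := cW (z @ \oo) (fmap_proper_filter z eventually_filter).
    by exists 0%N => // n _; have [] := zB n.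
  exists mu => N V /(clmu (lifts j W (B N)) V); apply.
  exists N => // n /= Nn; have [zW [nu nuE [m nm um]]] := zB n.
  by split=> //; exists nu => //; exists m => //=; exact: leq_trans nm.
have [y [yB ynu]] := lifts_sequence covC pjW muB.
have [nu nuE] : exists nu : fib j, set_val nu = restrict mu.
  have [oW _ _ Wj] := pieceP covC pjW.
  by apply: (restrict_fiber oW Wj); apply: closure_lifts (muB 0%N).
have /choice[m mP] n : exists m, (n <= m)%N /\ u m = y n.
  by have [m nm um] := yB n; exists m.
(* The index [m n] is at least [n], so these indices increase along [t]. *)
pose t := fix t a := if a is b.+1 then (m (t b)).+1 else 0%N.
have t_ge a : (a <= t a)%N.
  elim: a => // a IHa; rewrite ltnS; apply: (leq_trans IHa).
  by have [] := mP (t a).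
exists (m \o t), (glued_point nu); split.
  by apply/increasing_seqP => a; have [+ _] := mP (t a.+1); exact.
have -> : (u \o (m \o t)) = y \o t.
  by apply/funext => a /=; have [_ ->] := mP (t a).
apply: cvg_comp (ynu nu nuE); apply/cvgnyPge => N; exists N => // a /= Na.
exact: leq_trans (t_ge a).
Qed.

End GenericFiber.

Theorem corollaryA (R : realType) (k : closedFieldType) (X D : lrspace k)
    (i : mor D X) (A : atlas i)
    (hX : normal_variety X) (hD : effective_cartier i) :
  angelic (normalized_generic_fiber R A) /\
  (complete_scheme D -> sequentially_compact (normalized_generic_fiber R A)).
Proof.
have [_ [_ _ ftX]] := hX; split=> [|_]; first exact: fiber_angelic.
exact: fiber_sequentially_compact.
Qed.
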